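(* Let $k,p\in\mathbb{N}$, $s\in\mathbb{N}_0$, $Y_s=\{y_i\}_{i=1}^s$ with $-1<y_s<\dots<y_1<1$ (empty if $s=0$), $A_p=\{\alpha_i\}_{i=1}^p$ with $-1\le\alpha_p<\dots<\alpha_1\le1$, $Y_s\cap A_p=\emptyset$, and $$(r,m_1,m_2,m_3)\in\{(2j,2j-1,2j-2,2j-1): j\in\mathbb{N}\}\cup\{(2j+1,2j-1,2j,2j): j\in\mathbb{N}_0\}.$$ Let $f\in C^r[-1,1]$ and let $Z_n=\{z_j\}_{j=0}^n$, $-1=z_n<z_{n-1}<\dots<z_1<z_0=1$, be a knot sequence such that each nonempty open interval $(\beta_j,\beta_{j-1})$, $1\le j\le s+p+1$, contains at least $4(k+r-1)^2$ knots, where $Y_s\cup A_p=\{\beta_j\}_{j=1}^{s+p}$ with $\beta_{s+p}<\dots<\beta_1$, $\beta_0=1$, $\beta_{s+p+1}=-1$. Then there exists $S\in\Sigma_{k+r}(Z_n)\cap C^{k+r-2}[-1,1]$ such that $S-f\in\Delta^{(0)}(Y_s)$, $S^{(i)}(\alpha)=f^{(i)}(\alpha)$ for $\alpha\in A_p$, $0\le i\le m_1$ (vacuous if $m_1=-1$), $S^{(i)}(y)=f^{(i)}(y)$ for $y\in Y_s$, $0\le i\le m_2$, $S^{(i)}(\pm1)=f^{(i)}(\pm1)$ for $0\le i\le m_3$, and, for $0\le i\le n-1$, $$\|f-S\|_{C(J_i)}\le c\,|J_i|^r\,\omega_k(f^{(r)},|\widehat J_i|;\widehat J_i),\qquad c=c(k,r,\rho),$$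 where $\widehat J_i$ is an interval with $J_i\subset\widehat J_i\subseteq[z_{i+6(k+r-1)^2},z_{i-6(k+r-1)^2}]$.
   Context: Set $z_i:=-1$ for $i>n$, $z_i:=1$ for $i<0$, $J_i:=[z_i,z_{i-1}]$, and $\rho:=\max\{|J_{i\pm1}|/|J_i|: 1\le i\le n\}$. $\Sigma_m(Z_n)$ denotes the set of continuous piecewise polynomial functions on $[-1,1]$ which are polynomials of degree $\le m-1$ on each $[z_j,z_{j-1}]$. $\omega_k(g,t;J)$ is the $k$-th modulus of smoothness of $g$ on the interval $J$. With $y_0:=1$, $y_{s+1}:=-1$, $h\in\Delta^{(0)}(Y_s)$ iff $(-1)^ih\ge0$ on $[y_{i+1},y_i]$ for $0\le i\le s$ (for $s=0$ this means $h\ge0$ on $[-1,1]$). *)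

(* Defs.v *)
From Stdlib Require Import Reals Lra Lia ZArith List.
From Coquelicot Require Import Coquelicot.
Open Scope R_scope.

Definition deriv_within (a b : R) (g : R -> R) (x l : R) : Prop :=
  filterlim (fun y => (g y - g x) / (y - x))
    (within (fun y => a <= y <= b /\ y <> x) (locally x)) (locally l).

Definition cont_within (a b : R) (g : R -> R) (x : R) : Prop :=
  filterlim g (within (fun y => a <= y <= b) (locally x)) (locally (g x)).

Definition Cr_derivs (a b : R) (r : nat) (g : R -> R) (D : nat -> R -> R) : Prop :=
  (forall x, a <= x <= b -> D 0%nat x = g x) /\
  (forall i : nat, (i < r)%nat ->
     forall x, a <= x <= b -> deriv_within a b (D i) x (D (S i) x)) /\
  (forall x, a <= x <= b -> cont_within a b (D r) x).

Definition zext (z : nat -> R) (n : nat) (i : Z) : R :=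
  if (i <? 0)%Z then 1
  else if (Z.of_nat n <? i)%Z then -1
  else z (Z.to_nat i).

Definition knot_seq (z : nat -> R) (n : nat) : Prop :=
  z 0%nat = 1 /\ z n = -1 /\ (forall j : nat, (j < n)%nat -> z (S j) < z j).

Definition Jlen (z : nat -> R) (n : nat) (i : Z) : R :=
  zext z n (i - 1) - zext z n i.

Definition rho (z : nat -> R) (n : nat) : R :=
  fold_right Rmax 0
    (map (fun j : nat =>
            let i := Z.of_nat j in
            Rmax (Jlen z n (i - 1) / Jlen z n i) (Jlen z n (i + 1) / Jlen z n i))
         (seq 1 n)).

Definition knots_in (z : nat -> R) (n : nat) (a b : R) : nat :=
  length (filter (fun j => if Rlt_dec a (z j) then
                             if Rlt_dec (z j) b then true else false
                           else false) (seq 0 (S n))).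

Definition peval (cs : list R) (x : R) : R :=
  fold_right (fun c acc => c + x * acc) 0 cs.

Definition Sigma (m : nat) (z : nat -> R) (n : nat) (S : R -> R) : Prop :=
  (forall x, -1 <= x <= 1 -> cont_within (-1) 1 S x) /\
  (forall j : nat, (1 <= j <= n)%nat ->
     exists cs : list R, (length cs <= m)%nat /\
       forall x, z j <= x <= z (Nat.pred j) -> S x = peval cs x).

Definition fdiff (k : nat) (h : R) (g : R -> R) (x : R) : R :=
  sum_f_R0 (fun l => (-1) ^ (k - l) * Binomial.C k l * g (x + INR l * h)) k.

Definition omega (k : nat) (g : R -> R) (t a b : R) : R :=
  real (Lub_Rbar (fun v => exists h x, 0 < h <= t /\ a <= x /\ x + INR k * h <= b
                                   /\ v = Rabs (fdiff k h g x))).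

Definition yext (y : nat -> R) (s : nat) (i : nat) : R :=
  if Nat.eqb i 0 then 1 else if Nat.eqb i (S s) then -1 else y i.

Definition Delta0 (y : nat -> R) (s : nat) (h : R -> R) : Prop :=
  forall i : nat, (i <= s)%nat ->
    forall x, yext y s (S i) <= x <= yext y s i -> 0 <= (-1) ^ i * h x.

(* Main.v *)
Require Import Defs.
From Stdlib Require Import Reals Lra Lia ZArith List FunctionalExtensionality ClassicalEpsilon.
From Coquelicot Require Import Coquelicot.
Open Scope R_scope.

(** With [e = k + r - 1], the spline is a B-spline series of degree [e] on the given knots
    (repeated at the endpoints), whose j-th coefficient is read off a locally chosen polynomial.
    If the closed support of the j-th B-spline contains a breakpoint [v], that is, a point of Y or
    A or an endpoint (at most one, because many knots separate these points), that polynomial, the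
    anchor of [v], interpolates [f] at [v] and lies on the required side of [f]: to a Taylor
    polynomial with a Whitney remainder of size [w |x - v|^r] one adds a multiple of [(x - v)^q],
    where [q] is [r] or [r - 1], according to the parity that makes the difference change, or
    keep, its sign at [v].  Otherwise it is a local Whitney polynomial whose coefficient is moved
    in the required direction by a large multiple of the error bound.  On a knot interval the
    spline is a convex combination of its [e + 1] local coefficients, so it suffices to compare
    these with the coefficients of one reference polynomial: the anchor of [v] if its coefficient
    is present, and the local polynomial with the smallest error bound if not. *)

(** * Polynomials of a given order *)

(* The order is one more than the degree, as in [Sigma]. *)
Definition is_poly (m : nat) (f : R -> R) : Prop :=
  exists cs : list R, (length cs <= m)%nat /\ forall x, f x = peval cs x.

Lemma is_poly_zero m : is_poly m (fun _ => 0).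
Proof. exists nil; split; [simpl; lia | reflexivity]. Qed.

Lemma is_poly_0_inv f : is_poly 0 f -> forall x, f x = 0.
Proof.
  intros [[|c cs] [Hlen Hf]] x; [now rewrite Hf | simpl in Hlen; lia].
Qed.

Lemma is_poly_ext m f g : (forall x, f x = g x) -> is_poly m f -> is_poly m g.
Proof.
  intros Hfg [cs [Hlen Hf]]; exists cs; split; [exact Hlen | intros x; now rewrite <- Hfg].
Qed.

Lemma is_poly_le m m' f : (m <= m')%nat -> is_poly m f -> is_poly m' f.
Proof. intros Hm [cs [Hlen Hf]]; exists cs; split; [lia | exact Hf]. Qed.

Lemma is_poly_horner m c g : is_poly m g -> is_poly (S m) (fun x => c + x * g x).
Proof.
  intros [cs [Hlen Hg]]; exists (c :: cs); split; [simpl; lia|].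
  intros x; simpl; now rewrite Hg.
Qed.

Lemma is_poly_horner_inv m f : is_poly (S m) f ->
  exists c g, is_poly m g /\ forall x, f x = c + x * g x.
Proof.
  intros [[|c cs] [Hlen Hf]].
  - exists 0, (fun _ => 0); split; [apply is_poly_zero|].
    intros x; rewrite Hf; simpl; ring.
  - exists c, (peval cs); split; [exists cs; split; [simpl in Hlen; lia | easy] |].
    intros x; now rewrite Hf.
Qed.

Lemma is_poly_plus m f g : is_poly m f -> is_poly m g -> is_poly m (fun x => f x + g x).
Proof.
  revert f g; induction m as [|m IH]; intros f g Hf Hg.
  - apply is_poly_ext with (fun _ => 0); [|apply is_poly_zero].
    intros x; rewrite (is_poly_0_inv _ Hf), (is_poly_0_inv _ Hg); ring.
  - destruct (is_poly_horner_inv _ _ Hf) as [c [f1 [Hf1 Ef]]].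
    destruct (is_poly_horner_inv _ _ Hg) as [d [g1 [Hg1 Eg]]].
    apply is_poly_ext with (fun x => (c + d) + x * (f1 x + g1 x)).
    + intros x; rewrite Ef, Eg; ring.
    + apply is_poly_horner, IH; assumption.
Qed.

Lemma is_poly_scal m a f : is_poly m f -> is_poly m (fun x => a * f x).
Proof.
  revert f; induction m as [|m IH]; intros f Hf.
  - apply is_poly_ext with (fun _ => 0); [|apply is_poly_zero].
    intros x; rewrite (is_poly_0_inv _ Hf); ring.
  - destruct (is_poly_horner_inv _ _ Hf) as [c [f1 [Hf1 Ef]]].
    apply is_poly_ext with (fun x => a * c + x * (a * f1 x)).
    + intros x; rewrite Ef; ring.
    + apply is_poly_horner, IH; assumption.
Qed.

Lemma is_poly_minus m f g : is_poly m f -> is_poly m g -> is_poly m (fun x => f x - g x).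
Proof.
  intros Hf Hg; apply is_poly_ext with (fun x => f x + (-1) * g x); [intros; ring|].
  apply is_poly_plus; [|apply is_poly_scal]; assumption.
Qed.

Lemma is_poly_const m c : is_poly (S m) (fun _ => c).
Proof.
  apply is_poly_ext with (fun x => c + x * 0); [intros; ring|].
  apply is_poly_horner, is_poly_zero.
Qed.

Lemma is_poly_mult_affine m a b f : is_poly m f -> is_poly (S m) (fun x => (a + b * x) * f x).
Proof.
  intros Hf; apply is_poly_ext with (fun x => a * f x + (0 + x * (b * f x))); [intros; ring|].
  apply is_poly_plus.
  - apply is_poly_scal, is_poly_le with m; [lia | exact Hf].
  - apply (is_poly_horner m 0 (fun x => b * f x)), is_poly_scal, Hf.
Qed.

Lemma is_poly_comp_affine m a b f : is_poly m f -> is_poly m (fun x => f (a + b * x)).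
Proof.
  revert f; induction m as [|m IH]; intros f Hf.
  - apply is_poly_ext with (fun _ => 0); [|apply is_poly_zero].
    intros x; now rewrite (is_poly_0_inv _ Hf).
  - destruct (is_poly_horner_inv _ _ Hf) as [c [f1 [Hf1 Ef]]].
    apply is_poly_ext with (fun x => c + (a + b * x) * f1 (a + b * x)).
    + intros x; now rewrite Ef.
    + apply (is_poly_plus (S m) (fun _ => c)); [apply is_poly_const|].
      apply (is_poly_mult_affine m a b (fun x => f1 (a + b * x))), IH, Hf1.
Qed.

Lemma is_poly_pow n a : is_poly (S n) (fun x => (x - a) ^ n).
Proof.
  induction n as [|n IH]; [apply (is_poly_const 0 1)|].
  apply is_poly_ext with (fun x => (- a + 1 * x) * (x - a) ^ n); [intros; simpl; ring|].
  apply is_poly_mult_affine, IH.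
Qed.

Lemma is_poly_factor m f a : is_poly (S m) f ->
  exists g, is_poly m g /\ forall x, f x = f a + (x - a) * g x.
Proof.
  revert f; induction m as [|m IH]; intros f Hf;
    destruct (is_poly_horner_inv _ _ Hf) as [c [f1 [Hf1 Ef]]].
  - exists (fun _ => 0); split; [apply is_poly_zero|].
    intros x; rewrite !Ef, !(is_poly_0_inv _ Hf1); ring.
  - destruct (IH _ Hf1) as [g [Hg Eg]].
    exists (fun x => f1 a + x * g x); split; [now apply is_poly_horner|].
    intros x; rewrite !Ef, (Eg x); ring.
Qed.

Lemma is_derive_horner (f g : R -> R) (c a x l : R) : (forall u, f u = c + (u - a) * g u) ->
  is_derive g x l -> is_derive f x (g x + (x - a) * l).
Proof.
  intros Ef Dg; apply (is_derive_ext (fun u => c + (u - a) * g u)); [intros u; now rewrite Ef|].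
  auto_derive; [now exists l|].
  replace (Derive (fun u : R => g u) x) with l by (symmetry; apply is_derive_unique, Dg); ring.
Qed.

Lemma is_poly_is_derive m f : is_poly (S m) f ->
  exists f', is_poly m f' /\ forall x : R, is_derive f x (f' x).
Proof.
  revert f; induction m as [|m IH]; intros f Hf;
    destruct (is_poly_horner_inv _ _ Hf) as [c [f1 [Hf1 Ef]]].
  - exists (fun _ => 0); split; [apply is_poly_zero|].
    intros x; apply (is_derive_ext (fun _ => c)).
    + intros u; rewrite Ef, (is_poly_0_inv _ Hf1 u); simpl; ring.
    + apply (is_derive_const (V := R_NormedModule)).
  - destruct (IH _ Hf1) as [g [Hg Dg]].
    exists (fun x => f1 x + (0 + x * g x)); split.
    + apply is_poly_plus; [exact Hf1 | apply is_poly_horner, Hg].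
    + intros x; replace (f1 x + (0 + x * g x)) with (f1 x + (x - 0) * g x) by ring.
      apply (is_derive_horner f f1 c); [intros u; rewrite Ef; ring | apply Dg].
Qed.

Lemma is_poly_ex_derive m f x : is_poly m f -> ex_derive f x.
Proof.
  intros Hf; destruct (is_poly_is_derive m f) as [f' [_ Df]].
  - apply is_poly_le with m; [lia | exact Hf].
  - exists (f' x); apply Df.
Qed.

Lemma is_poly_Derive_S m f : is_poly (S m) f -> is_poly m (Derive f).
Proof.
  intros Hf; destruct (is_poly_is_derive m f Hf) as [f' [Hf' Df]].
  apply is_poly_ext with f'; [|exact Hf'].
  intros x; symmetry; apply is_derive_unique, Df.
Qed.

Lemma is_poly_Derive m f : is_poly m f -> is_poly m (Derive f).
Proof.
  intros Hf; apply is_poly_Derive_S, is_poly_le with m; [lia | exact Hf].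
Qed.

Lemma is_poly_Derive_n m f l : is_poly m f -> is_poly m (Derive_n f l).
Proof.
  intros Hf; induction l as [|l IH]; [exact Hf|].
  simpl; apply is_poly_Derive, IH.
Qed.

Lemma is_poly_ex_derive_n m f l x : is_poly m f -> ex_derive_n f l x.
Proof.
  intros Hf; destruct l as [|l]; [exact I|].
  apply (is_poly_ex_derive m), is_poly_Derive_n, Hf.
Qed.

Lemma is_poly_continuous m f (x : R) : is_poly m f -> continuous f x.
Proof.
  intros Hf; apply (ex_derive_continuous (K := R_AbsRing) (V := R_NormedModule)).
  apply (is_poly_ex_derive m), Hf.
Qed.

Lemma is_poly_Derive_n_plus_scal m f g a l x : is_poly m f -> is_poly m g ->
  Derive_n (fun u => f u + a * g u) l x = Derive_n f l x + a * Derive_n g l x.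
Proof.
  intros Hf Hg; rewrite <- Derive_n_scal_l.
  apply Derive_n_plus; apply filter_forall; intros u i _; apply (is_poly_ex_derive_n m);
    [exact Hf | now apply is_poly_scal].
Qed.

Lemma Derive_n_pow_sub l n a x : (l <= n)%nat ->
  Derive_n (fun u => (u - a) ^ n) l x = INR (fact n) / INR (fact (n - l)) * (x - a) ^ (n - l).
Proof.
  intros Hl; unfold Rminus; rewrite <- Derive_n_pow_smalli by exact Hl.
  apply (Derive_n_comp_trans (fun u => u ^ n)).
Qed.

(* Induction on the order needs the factor [u ^ s]: integrating [c + u * g u] passes from
   weight [s] to weight [s + 1]. *)
Lemma is_poly_weighted_primitive m s f : is_poly m f -> exists g, is_poly m g /\
  forall x : R, is_derive (fun u => u ^ S s * g u) x (x ^ s * f x).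
Proof.
  revert s f; induction m as [|m IH]; intros s f Hf.
  - exists (fun _ => 0); split; [apply is_poly_zero|].
    intros x; apply (is_derive_ext (fun _ => 0)); [intros u; simpl; ring|].
    rewrite (is_poly_0_inv _ Hf), Rmult_0_r.
    apply (is_derive_const (V := R_NormedModule)).
  - destruct (is_poly_horner_inv _ _ Hf) as [c [f1 [Hf1 Ef]]].
    destruct (IH (S s) f1 Hf1) as [g [Hg Dg]].
    assert (Hs : INR (S s) <> 0) by (apply not_0_INR; lia).
    exists (fun x => c / INR (S s) + x * g x); split; [now apply is_poly_horner|].
    intros x; apply (is_derive_ext (fun u => c / INR (S s) * u ^ S s + u ^ S (S s) * g u)).
    { intros u; simpl; ring. }
    replace (x ^ s * f x) with (c * x ^ s + x ^ S s * f1 x) by (rewrite Ef; simpl; ring).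
    apply (is_derive_plus (V := R_NormedModule)); [|apply Dg].
    auto_derive; [easy|].
    change (Nat.pred (S s)) with s; field; exact Hs.
Qed.

Lemma is_poly_primitive m f tau v : is_poly m f ->
  exists F, is_poly (S m) F /\ F tau = v /\ forall x : R, is_derive F x (f x).
Proof.
  intros Hf; destruct (is_poly_weighted_primitive m 0 f Hf) as [g [Hg Dg]].
  exists (fun x => (v - tau * g tau) + x * g x); split; [now apply is_poly_horner|].
  split; [ring|]; intros x.
  apply (is_derive_ext (fun u => (v - tau * g tau) + u ^ 1 * g u)); [intros u; simpl; ring|].
  replace (f x) with (0 + x ^ 0 * f x) by (simpl; ring).
  apply (is_derive_plus (V := R_NormedModule)); [|apply Dg].
  apply (is_derive_const (V := R_NormedModule)).
Qed.

Definition bounded_on (a b M : R) (f : R -> R) : Prop :=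
  forall x, a <= x <= b -> Rabs (f x) <= M.

(* Both extrapolation bounds below are by induction on the order: write
   [f x = f a + (x - a) * g x], where [g] is controlled on the half of [a, b] away from [a]. *)
Lemma is_poly_quotient_bound m f a b M : a < b -> is_poly (S m) f -> bounded_on a b M f ->
  exists g, is_poly m g /\ (forall x, f x = f a + (x - a) * g x) /\
    bounded_on ((a + b) / 2) b (4 * M / (b - a)) g.
Proof.
  intros Hab Hf HM; destruct (is_poly_factor m f a Hf) as [g [Hg Eg]].
  exists g; split; [exact Hg | split; [exact Eg|]].
  intros x Hx; assert (Hprod : Rabs ((x - a) * g x) <= 2 * M).
  { replace ((x - a) * g x) with (f x + - f a) by (rewrite (Eg x); ring).
    apply Rle_trans with (1 := Rabs_triang _ _); rewrite Rabs_Ropp.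
    assert (Rabs (f x) <= M) by (apply HM; lra).
    assert (Rabs (f a) <= M) by (apply HM; lra); lra. }
  rewrite Rabs_mult, (Rabs_pos_eq (x - a)) in Hprod by lra.
  apply Rmult_le_reg_l with ((b - a) / 2); [lra|].
  replace ((b - a) / 2 * (4 * M / (b - a))) with (2 * M) by (field; lra).
  apply Rle_trans with (2 := Hprod), Rmult_le_compat_r; [apply Rabs_pos | lra].
Qed.

Lemma is_poly_extrapolation m K : 0 <= K -> exists C, 0 <= C /\ forall f a b M,
  a < b -> is_poly m f -> bounded_on a b M f ->
  bounded_on (a - K * (b - a)) (a + K * (b - a)) (C * M) f.
Proof.
  revert K; induction m as [|m IH]; intros K HK.
  - exists 0; split; [lra|]; intros f a b M Hab Hf HM x _.
    rewrite (is_poly_0_inv _ Hf), Rabs_R0; lra.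
  - destruct (IH (2 * K + 1)) as [C [HC IHC]]; [lra|].
    exists (1 + 4 * K * C); split; [nra|].
    intros f a b M Hab Hf HM x Hx.
    destruct (is_poly_quotient_bound m f a b M Hab Hf HM) as [g [Hg [Eg Bg]]].
    assert (fa_bound : Rabs (f a) <= M) by (apply HM; lra).
    assert (gx_bound : Rabs (g x) <= C * (4 * M / (b - a)))
      by (apply (IHC g ((a + b) / 2) b); [lra | exact Hg | exact Bg | lra]).
    assert (xa_bound : Rabs (x - a) <= K * (b - a)) by (apply Rabs_le; lra).
    assert (Hprod := Rmult_le_compat _ _ _ _ (Rabs_pos _) (Rabs_pos _) xa_bound gx_bound).
    replace ((1 + 4 * K * C) * M) with (M + K * (b - a) * (C * (4 * M / (b - a))))
      by (field; lra).
    rewrite Eg; apply Rle_trans with (1 := Rabs_triang _ _); rewrite Rabs_mult; lra.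
Qed.

Lemma is_poly_Derive_bound m K : 0 <= K -> exists C, 0 <= C /\ forall f a b M,
  a < b -> is_poly m f -> bounded_on a b M f ->
  bounded_on (a - K * (b - a)) (a + K * (b - a)) (C * M / (b - a)) (Derive f).
Proof.
  revert K; induction m as [|m IH]; intros K HK.
  - exists 0; split; [lra|]; intros f a b M Hab Hf HM x _.
    rewrite (is_poly_0_inv _ (is_poly_Derive _ _ Hf)), Rabs_R0; unfold Rdiv; lra.
  - destruct (IH (2 * K + 1)) as [C1 [HC1 IHC]]; [lra|].
    destruct (is_poly_extrapolation m (2 * K + 1)) as [C0 [HC0 Hext]]; [lra|].
    exists (4 * C0 + 8 * K * C1); split; [nra|].
    intros f a b M Hab Hf HM x Hx.
    destruct (is_poly_quotient_bound m f a b M Hab Hf HM) as [g [Hg [Eg Bg]]].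
    assert (gx_bound : Rabs (g x) <= C0 * (4 * M / (b - a)))
      by (apply (Hext g ((a + b) / 2) b); [lra | exact Hg | exact Bg | lra]).
    assert (g'x_bound : Rabs (Derive g x) <= C1 * (4 * M / (b - a)) / (b - (a + b) / 2))
      by (apply (IHC g ((a + b) / 2) b); [lra | exact Hg | exact Bg | lra]).
    assert (xa_bound : Rabs (x - a) <= K * (b - a)) by (apply Rabs_le; lra).
    assert (Hprod := Rmult_le_compat _ _ _ _ (Rabs_pos _) (Rabs_pos _) xa_bound g'x_bound).
    assert (f'x : Derive f x = g x + (x - a) * Derive g x).
    { apply is_derive_unique, (is_derive_horner f g (f a)); [exact Eg|].
      now apply Derive_correct, (is_poly_ex_derive m). }
    replace ((4 * C0 + 8 * K * C1) * M / (b - a)) with (C0 * (4 * M / (b - a))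
      + K * (b - a) * (C1 * (4 * M / (b - a)) / (b - (a + b) / 2))) by (field; lra).
    rewrite f'x; apply Rle_trans with (1 := Rabs_triang _ _); rewrite Rabs_mult; lra.
Qed.

Lemma pow_bound_of_derive (u v : R -> R) (a b tau A : R) s : 0 <= A -> a <= tau <= b ->
  continuity u -> (forall x : R, a < x < b -> is_derive u x (v x)) -> u tau = 0 ->
  (forall x, a <= x <= b -> Rabs (v x) <= A * Rabs (x - tau) ^ s) ->
  forall x, a <= x <= b -> Rabs (u x) <= A * Rabs (x - tau) ^ S s.
Proof.
  intros HA Htau Cu Du Hu Hv x Hx.
  destruct (MVT_gen u tau x v) as [c [Hc Eux]].
  - intros w Hw; apply Du; revert Hw; unfold Rmin, Rmax; destruct (Rle_dec tau x); lra.
  - intros w _; apply Cu.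
  - rewrite Hu, Rminus_0_r in Eux; rewrite Eux, Rabs_mult.
    assert (c_between : a <= c <= b /\ Rabs (c - tau) <= Rabs (x - tau)).
    { revert Hc; unfold Rmin, Rmax; destruct (Rle_dec tau x); intros Hc; (split; [lra|]).
      - rewrite !Rabs_pos_eq; lra.
      - rewrite !Rabs_left1; lra. }
    simpl; rewrite (Rmult_comm (Rabs (x - tau)) (_ ^ s)), <- Rmult_assoc.
    apply Rmult_le_compat_r; [apply Rabs_pos|].
    apply Rle_trans with (1 := Hv c (proj1 c_between)).
    apply Rmult_le_compat_l; [exact HA|].
    apply pow_incr; split; [apply Rabs_pos | apply c_between].
Qed.

Definition osculates (q : nat) (tau : R) (D : nat -> R -> R) (P : R -> R) : Prop :=
  forall l : nat, (l < q)%nat -> Derive_n P l tau = D l tau.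

Lemma osculating_poly_approx r m (D : nat -> R -> R) (a b tau : R) (Q : R -> R) (A : R) :
  a <= tau <= b -> (forall i, (i <= r)%nat -> continuity (D i)) ->
  (forall (i : nat) (x : R), (i < r)%nat -> a < x < b -> is_derive (D i) x (D (S i) x)) ->
  is_poly m Q -> 0 <= A -> bounded_on a b A (fun x => D r x - Q x) ->
  exists P, is_poly (m + r) P /\ osculates r tau D P /\
    forall x, a <= x <= b -> Rabs (D 0%nat x - P x) <= A * Rabs (x - tau) ^ r.
Proof.
  intros Htau; revert D; induction r as [|r IH]; intros D CD DD HQ HA HD.
  - exists Q; split; [now rewrite Nat.add_0_r|]; split; [intros l Hl; lia|].
    intros x Hx; simpl; rewrite Rmult_1_r; now apply HD.
  - destruct (IH (fun i => D (S i))) as [P1 [HP1 [oscP1 nearP1]]]; auto.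
    + intros; apply CD; lia.
    + intros; apply DD; [lia | assumption].
    + destruct (is_poly_primitive (m + r) P1 tau (D 0%nat tau) HP1) as [P [HP [Ptau DP]]].
      exists P; split; [now rewrite Nat.add_succ_r|]; split.
      * intros [|l] Hl; [exact Ptau|].
        rewrite <- Nat.add_1_r, <- (Derive_n_comp P l 1), Nat.add_1_r.
        rewrite (Derive_n_ext (Derive_n P 1) P1); [apply oscP1; lia|].
        intros x; apply is_derive_unique, DP.
      * apply (pow_bound_of_derive (fun x => D 0%nat x - P x) (fun x => D 1%nat x - P1 x));
          auto.
        -- intros x; apply continuity_pt_minus; [apply CD; lia|].
           apply continuity_pt_filterlim, (is_poly_continuous _ _ _ HP).
        -- intros x Hx; apply (is_derive_minus (V := R_NormedModule)); [|apply DP].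
           apply DD; [lia | exact Hx].
        -- rewrite Ptau; ring.
Qed.

(** * Whitney's theorem *)

Lemma pow_neg1_mult_self n : (-1) ^ n * (-1) ^ n = 1.
Proof. rewrite <- pow_add; replace (n + n)%nat with (2 * n)%nat by lia; apply pow_1_even. Qed.

Lemma sum_f_R0_rev (F : nat -> R) n : sum_f_R0 F n = sum_f_R0 (fun l => F (n - l)%nat) n.
Proof.
  revert F; induction n as [|n IH]; intros F; [reflexivity|].
  rewrite (decomp_sum (fun l => F (S n - l)%nat)) by lia.
  rewrite tech5, IH, Rplus_comm; reflexivity.
Qed.

Lemma is_derive_sum_f_R0 (F G : nat -> R -> R) n x : (forall i, is_derive (F i) x (G i x)) ->
  is_derive (fun u => sum_f_R0 (fun i => F i u) n) x (sum_f_R0 (fun i => G i x) n).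
Proof.
  intros DF; induction n as [|n IH]; [apply DF|].
  simpl; apply (is_derive_plus (V := R_NormedModule)); [exact IH | apply DF].
Qed.

Lemma continuity_sum_f_R0 (F : nat -> R -> R) n : (forall i, continuity (F i)) ->
  continuity (fun x => sum_f_R0 (fun i => F i x) n).
Proof.
  intros CF; induction n as [|n IH]; [apply CF|].
  intros x; apply (continuity_pt_plus (fun u => sum_f_R0 (fun i => F i u) n) (F (S n)));
    [apply IH | apply CF].
Qed.

Lemma continuity_comp_affine a b f : continuity f -> continuity (fun x => f (a + b * x)).
Proof. intros Cf; apply (continuity_comp (fun x => a + b * x) f); [reg | exact Cf]. Qed.

Lemma continuity_of_is_derive (f f' : R -> R) :
  (forall x : R, is_derive f x (f' x)) -> continuity f.
Proof.
  intros Df x; apply derivable_continuous_pt, ex_derive_Reals_0; exists (f' x); apply Df.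
Qed.

Lemma continuity_ex_RInt f a b : continuity f -> ex_RInt f a b.
Proof.
  intros Cf; apply (ex_RInt_continuous (V := R_CompleteNormedModule)).
  intros x _; apply continuity_pt_filterlim, Cf.
Qed.

(** ** Finite differences *)

Definition binomial_weight (k l : nat) : R := (-1) ^ (k - l) * Binomial.C k l.

Lemma fdiff_0 h g x : fdiff 0 h g x = g x.
Proof.
  unfold fdiff; simpl; rewrite C_n_0.
  replace (x + 0 * h) with x by ring; ring.
Qed.

Lemma fdiff_S k h g x : fdiff (S k) h g x = fdiff k h g (x + h) - fdiff k h g x.
Proof.
  set (G := fun l => g (x + INR l * h)).
  assert (E_shift : fdiff k h g (x + h) =
    sum_f_R0 (fun l => binomial_weight k l * G (S l)) k).
  { apply sum_eq; intros l _; unfold binomial_weight, G; rewrite S_INR; do 2 f_equal; ring. }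
  rewrite E_shift; unfold fdiff; fold (binomial_weight k) G; clear E_shift.
  change (sum_f_R0 (fun l => binomial_weight (S k) l * G l) (S k) =
    sum_f_R0 (fun l => binomial_weight k l * G (S l)) k -
    sum_f_R0 (fun l => binomial_weight k l * G l) k).
  assert (w_top : forall m, binomial_weight m m = 1)
    by (intros m; unfold binomial_weight; rewrite Nat.sub_diag, C_n_n; simpl; ring).
  assert (w_bottom : binomial_weight (S k) 0 = - binomial_weight k 0)
    by (unfold binomial_weight; rewrite !C_n_0, !Nat.sub_0_r; simpl; ring).
  assert (w_pascal : forall l, (l < k)%nat ->
    binomial_weight (S k) (S l) = binomial_weight k l - binomial_weight k (S l)).
  { intros l Hl; unfold binomial_weight; rewrite <- pascal by exact Hl.
    replace (S k - S l)%nat with (S (k - S l)) by lia.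
    replace (k - l)%nat with (S (k - S l)) by lia; simpl pow; ring. }
  destruct k as [|k]; [simpl; rewrite w_bottom, !w_top; ring|].
  rewrite (decomp_sum (fun l => binomial_weight (S (S k)) l * G l)) by lia.
  rewrite (decomp_sum (fun l => binomial_weight (S k) l * G l)) by lia.
  simpl Nat.pred; rewrite !tech5, w_bottom, !w_top.
  rewrite (sum_eq (fun l => binomial_weight (S (S k)) (S l) * G (S l)) (fun l =>
    binomial_weight (S k) l * G (S l) - binomial_weight (S k) (S l) * G (S l)))
    by (intros l Hl; rewrite w_pascal by lia; ring).
  rewrite minus_sum; ring.
Qed.

Lemma fdiff_step_0 k g x : (1 <= k)%nat -> fdiff k 0 g x = 0.
Proof. intros Hk; destruct k as [|k]; [lia|]; rewrite fdiff_S, Rplus_0_r; ring. Qed.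

Lemma fdiff_comp_affine k h g a b x :
  fdiff k h (fun u => g (a + b * u)) x = fdiff k (b * h) g (a + b * x).
Proof. apply sum_eq; intros l _; do 2 f_equal; ring. Qed.

Lemma fdiff_opp_step k h g x : fdiff k (- h) g x = (-1) ^ k * fdiff k h g (x - INR k * h).
Proof.
  unfold fdiff; rewrite sum_f_R0_rev, scal_sum.
  apply sum_eq; intros l Hl.
  rewrite <- pascal_step1 by exact Hl; rewrite minus_INR by exact Hl.
  replace (k - (k - l))%nat with l by lia.
  replace (x + (INR k - INR l) * - h) with (x - INR k * h + INR l * h) by ring.
  replace ((-1) ^ k) with ((-1) ^ (k - l) * (-1) ^ l) by (rewrite <- pow_add; f_equal; lia).
  rewrite <- (Rmult_1_l ((-1) ^ l * _ * _)), <- (pow_neg1_mult_self (k - l)); ring.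
Qed.

Lemma continuity_fdiff k h g : continuity g -> continuity (fdiff k h g).
Proof.
  intros Cg; unfold fdiff.
  apply (continuity_sum_f_R0 (fun l x => binomial_weight k l * g (x + INR l * h))).
  intros l; apply (continuity_scal (fun x => g (x + INR l * h))).
  intros x; apply (continuity_pt_ext (fun x => g (INR l * h + 1 * x)));
    [intros u; f_equal; ring | now apply continuity_comp_affine].
Qed.

Lemma continuity_fdiff_step k g x : continuity g -> continuity (fun h => fdiff k h g x).
Proof.
  intros Cg; apply (continuity_sum_f_R0 (fun l h => binomial_weight k l * g (x + INR l * h))).
  intros l; apply (continuity_scal (fun h => g (x + INR l * h))).
  now apply continuity_comp_affine.
Qed.

Definition fdiff_bounded (k : nat) (a b W : R) (g : R -> R) : Prop :=
  forall h x, 0 < h -> a <= x -> x + INR k * h <= b -> Rabs (fdiff k h g x) <= W.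

Definition diff_quot (h : R) (g : R -> R) (x : R) : R := (g (x + h) - g x) / h.

Definition fdiff_quot (k : nat) (h : R) (g : R -> R) (x : R) : R := fdiff k h g x / h ^ k.

Lemma diff_quot_fdiff_quot k h g x : h <> 0 ->
  diff_quot h (fdiff_quot k h g) x = fdiff_quot (S k) h g x.
Proof.
  intros Hh; unfold diff_quot, fdiff_quot; rewrite fdiff_S; simpl; field.
  split; [now apply pow_nonzero | exact Hh].
Qed.

Lemma continuity_fdiff_quot k h g : continuity g -> continuity (fdiff_quot k h g).
Proof.
  intros Cg x; apply (continuity_pt_ext (fun u => / h ^ k * fdiff k h g u));
    [intros u; apply Rmult_comm | now apply (continuity_scal (fdiff k h g)), continuity_fdiff].
Qed.

(** ** Steklov means *)

Definition steklov (h : R) (g : R -> R) (x : R) : R := RInt g x (x + h) / h.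

Definition steklov_iter (n : nat) (h : R) (g : R -> R) : R -> R := Nat.iter n (steklov h) g.

Lemma is_derive_steklov h g (x : R) : continuity g -> is_derive (steklov h g) x (diff_quot h g x).
Proof.
  intros Cg; assert (Dprim : forall u : R, is_derive (RInt g 0) u (g u)).
  { intros u; apply (is_derive_RInt g (RInt g 0) 0).
    - apply filter_forall; intros v.
      apply (RInt_correct (V := R_CompleteNormedModule)), continuity_ex_RInt, Cg.
    - apply continuity_pt_filterlim, Cg. }
  apply (is_derive_ext (fun u => (RInt g 0 (u + h) - RInt g 0 u) * / h)).
  { intros u; unfold steklov, Rdiv; f_equal.
    rewrite <- (RInt_Chasles g 0 u (u + h)) by (now apply continuity_ex_RInt).
    unfold plus; simpl; ring. }
  revert Dprim; generalize (RInt g 0); intros G DG; unfold diff_quot, Rdiv.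
  auto_derive.
  - repeat split; [exists (g (x + h)) | exists (g x)]; apply DG.
  - replace (Derive (fun u : R => G u) (x + h)) with (g (x + h))
      by (symmetry; apply is_derive_unique, DG).
    replace (Derive (fun u : R => G u) x) with (g x)
      by (symmetry; apply is_derive_unique, DG).
    ring.
Qed.

Lemma continuity_steklov h g : continuity g -> continuity (steklov h g).
Proof.
  intros Cg; apply continuity_of_is_derive with (diff_quot h g).
  intros x; now apply is_derive_steklov.
Qed.

Lemma continuity_steklov_iter n h g : continuity g -> continuity (steklov_iter n h g).
Proof. intros Cg; induction n as [|n IH]; [exact Cg | now apply continuity_steklov]. Qed.

Lemma steklov_plus h f g x : continuity f -> continuity g ->
  steklov h (fun u => f u + g u) x = steklov h f x + steklov h g x.
Proof.
  intros Cf Cg; unfold steklov.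
  rewrite (RInt_plus (V := R_CompleteNormedModule) f g) by (now apply continuity_ex_RInt).
  unfold plus; simpl; unfold Rdiv; ring.
Qed.

Lemma steklov_scal h a f x : continuity f -> steklov h (fun u => a * f u) x = a * steklov h f x.
Proof.
  intros Cf; unfold steklov.
  rewrite (RInt_scal (V := R_CompleteNormedModule) f) by (now apply continuity_ex_RInt).
  unfold scal; simpl; unfold mult; simpl; unfold Rdiv; ring.
Qed.

Lemma steklov_comp_affine h g a b x : continuity g -> b <> 0 ->
  steklov h (fun u => g (a + b * u)) x = steklov (b * h) g (a + b * x).
Proof.
  intros Cg Hb; unfold steklov.
  assert (E : b * RInt (fun u => g (a + b * u)) x (x + h) =
    RInt g (a + b * x) (a + b * x + b * h)).
  { replace (a + b * x) with (b * x + a) by ring.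
    replace (b * x + a + b * h) with (b * (x + h) + a) by ring.
    rewrite <- (RInt_comp_lin (V := R_CompleteNormedModule)) by (now apply continuity_ex_RInt).
    rewrite <- (RInt_scal (V := R_CompleteNormedModule) (fun u => g (a + b * u)))
      by (now apply continuity_ex_RInt, continuity_comp_affine).
    apply RInt_ext; intros u _; rewrite (Rplus_comm a); reflexivity. }
  unfold Rdiv; rewrite <- E, Rinv_mult, (Rmult_comm b (RInt _ _ _)), Rmult_assoc.
  now rewrite <- (Rmult_assoc b), Rinv_r, Rmult_1_l.
Qed.

Lemma steklov_sum h (a : nat -> R) (F : nat -> R -> R) n x : (forall i, continuity (F i)) ->
  steklov h (fun u => sum_f_R0 (fun i => a i * F i u) n) x =
  sum_f_R0 (fun i => a i * steklov h (F i) x) n.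
Proof.
  intros CF; induction n as [|n IH]; [now apply steklov_scal|].
  simpl; rewrite <- IH, <- (steklov_scal h (a (S n))) by apply CF.
  apply (steklov_plus h (fun u => sum_f_R0 (fun i => a i * F i u) n)).
  - apply (continuity_sum_f_R0 (fun i u => a i * F i u)).
    intros i; apply (continuity_scal (F i)), CF.
  - apply (continuity_scal (F (S n))), CF.
Qed.

Lemma steklov_iter_sum m h (a : nat -> R) (F : nat -> R -> R) n :
  (forall i, continuity (F i)) ->
  steklov_iter m h (fun u => sum_f_R0 (fun i => a i * F i u) n) =
  fun x => sum_f_R0 (fun i => a i * steklov_iter m h (F i) x) n.
Proof.
  intros CF; induction m as [|m IH]; [reflexivity|].
  simpl; rewrite IH; apply functional_extensionality; intros x.
  apply steklov_sum; intros i; now apply continuity_steklov_iter.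
Qed.

Lemma steklov_iter_const n h a : h <> 0 -> steklov_iter n h (fun _ => a) = fun _ => a.
Proof.
  intros Hh; induction n as [|n IH]; [reflexivity|].
  simpl; rewrite IH; apply functional_extensionality; intros x; unfold steklov.
  rewrite RInt_const; unfold scal; simpl; unfold mult; simpl; field; exact Hh.
Qed.

Lemma steklov_iter_comp_affine n h g a b : continuity g -> b <> 0 ->
  steklov_iter n h (fun u => g (a + b * u)) = fun x => steklov_iter n (b * h) g (a + b * x).
Proof.
  intros Cg Hb; induction n as [|n IH]; [reflexivity|].
  simpl; rewrite IH; apply functional_extensionality; intros x.
  now apply steklov_comp_affine; [apply continuity_steklov_iter|].
Qed.

Lemma steklov_diff_quot h g x : continuity g ->
  steklov h (diff_quot h g) x = diff_quot h (steklov h g) x.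
Proof.
  intros Cg.
  assert (Cshift : continuity (fun u => g (h + 1 * u))) by (now apply continuity_comp_affine).
  replace (diff_quot h g) with (fun u => / h * g (h + 1 * u) + (- / h) * g u).
  - rewrite (steklov_plus h (fun u => / h * g (h + 1 * u)) (fun u => (- / h) * g u)),
      !steklov_scal, steklov_comp_affine; auto; try lra.
    + unfold diff_quot; rewrite !Rmult_1_l, (Rplus_comm h x); unfold Rdiv; ring.
    + now apply (continuity_scal (fun u => g (h + 1 * u))).
    + now apply (continuity_scal g).
  - apply functional_extensionality; intros u; unfold diff_quot.
    rewrite Rmult_1_l, (Rplus_comm h u); unfold Rdiv; ring.
Qed.

Lemma steklov_iter_diff_quot n h g : continuity g ->
  steklov_iter n h (diff_quot h g) = diff_quot h (steklov_iter n h g).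
Proof.
  intros Cg; induction n as [|n IH]; [reflexivity|].
  simpl; rewrite IH; apply functional_extensionality; intros x.
  now apply steklov_diff_quot, continuity_steklov_iter.
Qed.

Lemma is_derive_steklov_iter n h g (x : R) : continuity g ->
  is_derive (steklov_iter (S n) h g) x (steklov_iter n h (diff_quot h g) x).
Proof.
  intros Cg; rewrite steklov_iter_diff_quot by exact Cg.
  now apply is_derive_steklov, continuity_steklov_iter.
Qed.

Lemma bounded_on_steklov h g a b W : 0 < h -> continuity g ->
  bounded_on a (b + h) W g -> bounded_on a b W (steklov h g).
Proof.
  intros Hh Cg HW x Hx; unfold steklov, Rdiv.
  rewrite Rabs_mult, (Rabs_pos_eq (/ h)) by (left; now apply Rinv_0_lt_compat).
  apply Rmult_le_reg_r with h; [exact Hh|].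
  rewrite Rmult_assoc, Rinv_l, Rmult_1_r by lra.
  rewrite Rmult_comm; replace h with ((x + h) - x) at 2 by ring.
  apply abs_RInt_le_const; [lra | now apply continuity_ex_RInt | intros; apply HW; lra].
Qed.

Lemma bounded_on_steklov_iter n h g a b W : 0 < h -> continuity g ->
  bounded_on a (b + INR n * h) W g -> bounded_on a b W (steklov_iter n h g).
Proof.
  intros Hh Cg; revert b; induction n as [|n IH]; intros b HW.
  - intros x Hx; apply HW; simpl; lra.
  - apply bounded_on_steklov; [exact Hh | now apply continuity_steklov_iter|].
    apply IH; intros x Hx; apply HW; rewrite S_INR; lra.
Qed.

Lemma INR_S_mult_pos l d : 0 < d -> 0 < INR (S l) * d.
Proof. intros Hd; apply Rmult_lt_0_compat; [apply lt_0_INR; lia | exact Hd]. Qed.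

Lemma fdiff_bounded_nonneg k a b W g : (1 <= k)%nat -> a < b -> fdiff_bounded k a b W g -> 0 <= W.
Proof.
  intros Hk Hab HW; assert (HK : 0 < INR k) by (apply lt_0_INR; lia).
  apply Rle_trans with (1 := Rabs_pos (fdiff k ((b - a) / INR k) g a)), HW.
  - apply Rdiv_lt_0_compat; lra.
  - lra.
  - right; field; lra.
Qed.

Section WhitneySmoothing.

Variables (k : nat) (d : R) (g : R -> R).
Hypotheses (k_pos : (1 <= k)%nat) (d_pos : 0 < d) (g_cont : continuity g).

Definition smoothing_term (i l : nat) (x : R) : R :=
  binomial_weight k (S l) *
    steklov_iter (k - i) (INR (S l) * d) (fdiff_quot i (INR (S l) * d) g) x.

(* [g - smoothing 0] is, up to sign, an iterated mean of the k-th differences of [g], because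
   the term [l = 0] of these differences is [g] itself; differentiating the iterated means
   turns [smoothing k] into a combination of k-th difference quotients. *)
Definition smoothing (i : nat) (x : R) : R :=
  - (-1) ^ k * sum_f_R0 (fun l => smoothing_term i l x) (Nat.pred k).

Lemma continuity_smoothing i : continuity (smoothing i).
Proof.
  apply (continuity_scal (fun x => sum_f_R0 (fun l => smoothing_term i l x) (Nat.pred k))).
  apply continuity_sum_f_R0; intros l.
  apply (continuity_scal (steklov_iter _ _ (fdiff_quot _ _ g))).
  now apply continuity_steklov_iter, continuity_fdiff_quot.
Qed.

Lemma is_derive_smoothing_term i l (x : R) : (i < k)%nat ->
  is_derive (smoothing_term i l) x (smoothing_term (S i) l x).
Proof.
  intros Hi; apply (is_derive_scal (steklov_iter _ _ (fdiff_quot _ _ g))).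
  replace (fdiff_quot (S i) (INR (S l) * d) g)
    with (diff_quot (INR (S l) * d) (fdiff_quot i (INR (S l) * d) g)).
  - replace (k - i)%nat with (S (k - S i)) by lia.
    now apply is_derive_steklov_iter, continuity_fdiff_quot.
  - apply functional_extensionality; intros u.
    apply diff_quot_fdiff_quot, Rgt_not_eq, INR_S_mult_pos, d_pos.
Qed.

Lemma is_derive_smoothing i (x : R) : (i < k)%nat ->
  is_derive (smoothing i) x (smoothing (S i) x).
Proof.
  intros Hi.
  apply (is_derive_scal (fun x => sum_f_R0 (fun l => smoothing_term i l x) (Nat.pred k))).
  apply is_derive_sum_f_R0; intros l; now apply is_derive_smoothing_term.
Qed.

Lemma sub_smoothing_0 x :
  g x - smoothing 0 x = (-1) ^ k * steklov_iter k d (fun h => fdiff k h g x) 0.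
Proof.
  assert (Cline : forall l, continuity (fun h => g (x + INR l * h)))
    by (intros l; now apply continuity_comp_affine).
  unfold fdiff.
  rewrite (steklov_iter_sum k d (binomial_weight k) (fun l h => g (x + INR l * h))) by exact Cline.
  rewrite decomp_sum by lia.
  replace (fun h : R => g (x + INR 0 * h)) with (fun _ : R => g x)
    by (apply functional_extensionality; intros h; f_equal; simpl; ring).
  rewrite steklov_iter_const by lra.
  rewrite (sum_eq _ (fun l => smoothing_term 0 l x)).
  - unfold smoothing, binomial_weight; rewrite Nat.sub_0_r, C_n_0.
    set (rest := sum_f_R0 _ _).
    transitivity (((-1) ^ k * (-1) ^ k) * g x + (-1) ^ k * rest);
      [rewrite pow_neg1_mult_self | ]; ring.
  - intros l _; unfold smoothing_term; rewrite Nat.sub_0_r; f_equal.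
    rewrite steklov_iter_comp_affine, Rmult_0_r, Rplus_0_r
      by (exact g_cont || (apply not_0_INR; lia)).
    f_equal; apply functional_extensionality; intros u.
    unfold fdiff_quot; rewrite fdiff_0; simpl; field.
Qed.

Variables (a b W : R).
Hypothesis g_diff : fdiff_bounded k a b W g.

Lemma sub_smoothing_0_bounded c : a < b -> c + INR k * (INR k * d) <= b ->
  bounded_on a c W (fun x => g x - smoothing 0 x).
Proof.
  intros Hab Hc x Hx; rewrite sub_smoothing_0, Rabs_mult, pow_1_abs, Rmult_1_l.
  apply (bounded_on_steklov_iter k d _ 0 0); [exact d_pos | | | lra].
  - now apply continuity_fdiff_step.
  - intros h Hh; destruct (Rle_lt_or_eq_dec 0 h) as [h_pos|<-]; [lra | |].
    + apply g_diff; [exact h_pos | lra |].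
      assert (INR k * h <= INR k * (INR k * d))
        by (apply Rmult_le_compat_l; [apply pos_INR | lra]).
      lra.
    + rewrite fdiff_step_0, Rabs_R0 by exact k_pos; now apply (fdiff_bounded_nonneg k a b W g).
Qed.

Lemma smoothing_k_bounded c : c + INR k * (INR k * d) <= b ->
  bounded_on a c (sum_f_R0 (fun l => Rabs (binomial_weight k (S l)) / (INR (S l) * d) ^ k)
    (Nat.pred k) * W) (smoothing k).
Proof.
  intros Hc x Hx; unfold smoothing.
  rewrite Rabs_mult, Rabs_Ropp, pow_1_abs, Rmult_1_l.
  apply Rle_trans with (1 := Rsum_abs _ _); rewrite Rmult_comm, scal_sum.
  apply sum_Rle; intros l Hl.
  assert (step_pow_pos : 0 < / (INR (S l) * d) ^ k)
    by (apply Rinv_0_lt_compat, pow_lt, INR_S_mult_pos, d_pos).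
  unfold smoothing_term; rewrite Nat.sub_diag.
  change (steklov_iter 0 (INR (S l) * d) (fdiff_quot k (INR (S l) * d) g) x)
    with (fdiff k (INR (S l) * d) g x * / (INR (S l) * d) ^ k).
  unfold Rdiv; rewrite !Rabs_mult, (Rabs_pos_eq (/ _)) by lra.
  rewrite Rmult_assoc; apply Rmult_le_compat_l; [apply Rabs_pos|].
  rewrite (Rmult_comm _ W); apply Rmult_le_compat_r; [lra|].
  apply g_diff; [apply INR_S_mult_pos, d_pos | lra |].
  assert (INR k * (INR (S l) * d) <= INR k * (INR k * d)).
  { apply Rmult_le_compat_l; [apply pos_INR|].
    apply Rmult_le_compat_r; [lra | apply le_INR; lia]. }
  lra.
Qed.

End WhitneySmoothing.

Lemma whitney_left k : (1 <= k)%nat -> exists C, 0 <= C /\ forall g W, continuity g ->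
  fdiff_bounded k 0 1 W g ->
  exists Q, is_poly k Q /\ bounded_on 0 (3 / 4) (C * W) (fun x => g x - Q x).
Proof.
  intros Hk; assert (HK : 1 <= INR k) by (apply (le_INR 1); exact Hk).
  set (d := / (4 * INR k * INR k)).
  assert (Hd : 0 < d) by (apply Rinv_0_lt_compat; nra).
  assert (HKd : 3 / 4 + INR k * (INR k * d) <= 1) by (right; unfold d; field; lra).
  set (CT := sum_f_R0 (fun l => Rabs (binomial_weight k (S l)) / (INR (S l) * d) ^ k)
    (Nat.pred k)).
  assert (HCT : 0 <= CT).
  { apply cond_pos_sum; intros l; apply Rmult_le_pos; [apply Rabs_pos|].
    left; apply Rinv_0_lt_compat, pow_lt, INR_S_mult_pos, Hd. }
  exists (1 + CT); split; [lra|].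
  intros g W Cg HW.
  assert (HW0 : 0 <= W) by (apply (fdiff_bounded_nonneg k 0 1 W g); (assumption || lra)).
  destruct (osculating_poly_approx k 0 (smoothing k d g) 0 (3 / 4) 0 (fun _ => 0) (CT * W))
    as [P [HP [_ nearP]]].
  - lra.
  - intros i _; now apply continuity_smoothing.
  - intros i x Hi _; now apply is_derive_smoothing.
  - apply is_poly_zero.
  - now apply Rmult_le_pos.
  - intros x Hx; rewrite Rminus_0_r.
    now apply (smoothing_k_bounded k d g Hk Hd 0 1 W HW (3 / 4)).
  - exists P; split; [exact HP|]; intros x Hx.
    replace (g x - P x) with ((g x - smoothing k d g 0 x) + (smoothing k d g 0 x - P x)) by ring.
    apply Rle_trans with (1 := Rabs_triang _ _).
    assert (g_near := sub_smoothing_0_bounded k d g Hk Hd Cg 0 1 W HW (3 / 4)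
      Rlt_0_1 HKd x Hx); simpl in g_near.
    assert (P_near := nearP x Hx).
    assert (x_pow : Rabs (x - 0) ^ k <= 1).
    { rewrite <- (pow1 k); apply pow_incr; split; [apply Rabs_pos|].
      rewrite Rabs_pos_eq; lra. }
    apply (Rmult_le_compat_l (CT * W)) in x_pow; [lra | now apply Rmult_le_pos].
Qed.

Lemma whitney_unit k : (1 <= k)%nat -> exists C, 0 <= C /\ forall g W, continuity g ->
  fdiff_bounded k 0 1 W g ->
  exists Q, is_poly k Q /\ bounded_on 0 1 (C * W) (fun x => g x - Q x).
Proof.
  intros Hk; destruct (whitney_left k Hk) as [C [HC Hleft]].
  destruct (is_poly_extrapolation k 2) as [C' [HC' Hext]]; [lra|].
  exists (C + C' * (2 * C)); split; [nra|].
  intros g W Cg HW.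
  assert (HW0 : 0 <= W) by (apply (fdiff_bounded_nonneg k 0 1 W g); (assumption || lra)).
  destruct (Hleft g W Cg HW) as [P [HP nearP]].
  destruct (Hleft (fun u => g (1 + (-1) * u)) W) as [P' [HP' nearP']].
  { now apply continuity_comp_affine. }
  { intros h x Hh Hx Hxh; rewrite fdiff_comp_affine.
    replace (-1 * h) with (- h) by ring; rewrite fdiff_opp_step.
    rewrite Rabs_mult, pow_1_abs, Rmult_1_l; apply HW; lra. }
  set (Q := fun x => P' (1 + (-1) * x)).
  assert (HQ : is_poly k Q) by (now apply is_poly_comp_affine).
  assert (nearQ : bounded_on (1 / 4) 1 (C * W) (fun x => g x - Q x)).
  { intros x Hx; specialize (nearP' (1 + (-1) * x) ltac:(lra)); simpl in nearP'.
    replace (1 + -1 * (1 + -1 * x)) with x in nearP' by ring; exact nearP'. }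
  assert (Q_near_P : bounded_on (1 / 4) (3 / 4) (2 * (C * W)) (fun x => Q x - P x)).
  { intros x Hx; replace (Q x - P x) with ((g x - P x) + - (g x - Q x)) by ring.
    apply Rle_trans with (1 := Rabs_triang _ _); rewrite Rabs_Ropp.
    specialize (nearP x ltac:(lra)); specialize (nearQ x ltac:(lra)); simpl in *; lra. }
  apply Hext in Q_near_P; [|lra | now apply is_poly_minus].
  assert (HCW : 0 <= C * W) by (now apply Rmult_le_pos).
  assert (HCW' : 0 <= C' * (2 * (C * W))) by (apply Rmult_le_pos; lra).
  exists P; split; [exact HP|]; intros x Hx.
  replace ((C + C' * (2 * C)) * W) with (C * W + C' * (2 * (C * W))) by ring.
  destruct (Rle_dec x (3 / 4)) as [x_left|x_right].
  - specialize (nearP x ltac:(lra)); simpl in nearP; lra.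
  - replace (g x - P x) with ((g x - Q x) + (Q x - P x)) by ring.
    apply Rle_trans with (1 := Rabs_triang _ _).
    specialize (nearQ x ltac:(lra)); specialize (Q_near_P x ltac:(lra)); simpl in *; lra.
Qed.

Theorem whitney k : (1 <= k)%nat -> exists C, 0 <= C /\ forall g a b W, continuity g -> a < b ->
  fdiff_bounded k a b W g ->
  exists Q, is_poly k Q /\ bounded_on a b (C * W) (fun x => g x - Q x).
Proof.
  intros Hk; destruct (whitney_unit k Hk) as [C [HC Hunit]].
  exists C; split; [exact HC|]; intros g a b W Cg Hab HW.
  destruct (Hunit (fun x => g (a + (b - a) * x)) W) as [Q [HQ nearQ]].
  - now apply continuity_comp_affine.
  - intros h x Hh Hx Hxh; rewrite fdiff_comp_affine; apply HW; nra.
  - exists (fun x => Q (- a / (b - a) + / (b - a) * x)); split;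
      [now apply is_poly_comp_affine|].
    intros x Hx; set (u := - a / (b - a) + / (b - a) * x).
    assert (Eu : a + (b - a) * u = x) by (unfold u; field; lra).
    rewrite <- Eu at 1; apply (nearQ u).
    split; nra.
Qed.

(** * De Boor's algorithm *)

(* [de_boor t e c e i] is the polynomial piece, between the knots [t (i + 1)] and [t i], of the
   spline of degree [e] with B-spline coefficients [c]; the knots decrease, as in the paper. *)
Fixpoint de_boor (t : Z -> R) (e : nat) (c : Z -> R) (l : nat) (j : Z) (x : R) : R :=
  match l with
  | O => c j
  | S l' =>
    ((x - t j) * de_boor t e c l' j x
      + (t (j + Z.of_nat (e - l'))%Z - x) * de_boor t e c l' (j - 1)%Z x)
    / (t (j + Z.of_nat (e - l'))%Z - t j)
  end.

Lemma de_boor_S t e c l j x : de_boor t e c (S l) j x =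
  ((x - t j) * de_boor t e c l j x
    + (t (j + Z.of_nat (e - l))%Z - x) * de_boor t e c l (j - 1)%Z x)
  / (t (j + Z.of_nat (e - l))%Z - t j).
Proof. reflexivity. Qed.

Lemma is_poly_de_boor t e c l j : is_poly (S l) (de_boor t e c l j).
Proof.
  revert j; induction l as [|l IH]; intros j; simpl; [apply is_poly_const|].
  set (T := t (j + Z.of_nat (e - l))%Z).
  apply is_poly_ext with (fun x => / (T - t j) * ((- t j + 1 * x) * de_boor t e c l j x
    + (T + (-1) * x) * de_boor t e c l (j - 1)%Z x)).
  - intros x; unfold Rdiv; ring.
  - apply is_poly_scal, is_poly_plus; apply is_poly_mult_affine, IH.
Qed.

Lemma de_boor_lin t e c c' a b l j x : de_boor t e (fun j => a * c j + b * c' j) l j x =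
  a * de_boor t e c l j x + b * de_boor t e c' l j x.
Proof.
  revert j; induction l as [|l IH]; intros j; simpl; [reflexivity|].
  rewrite !IH; unfold Rdiv; ring.
Qed.

Lemma de_boor_ext t e c c' l j x :
  (forall j', (j - Z.of_nat l <= j' <= j)%Z -> c j' = c' j') ->
  de_boor t e c l j x = de_boor t e c' l j x.
Proof.
  revert j; induction l as [|l IH]; intros j Hc; simpl; [apply Hc; lia|].
  rewrite (IH j), (IH (j - 1)%Z); [reflexivity | |]; intros; apply Hc; lia.
Qed.

Definition simple_knot (t : Z -> R) (i : Z) : Prop :=
  forall a b : Z, (a <= i <= b)%Z -> (a < b)%Z -> t a <> t b.

Lemma simple_knot_minus_neq_0 t i a b : simple_knot t i -> (a <= i <= b)%Z -> (a < b)%Z ->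
  t b - t a <> 0.
Proof. intros Ht Hab Hlt; now apply Rminus_eq_contra, not_eq_sym, Ht. Qed.

Definition divided_differences (t : Z -> R) (e : nat) (c : Z -> R) (j : Z) : R :=
  (c j - c (j - 1)%Z) / (t (j + Z.of_nat (S e))%Z - t j).

Lemma de_boor_difference t e c i : simple_knot t i ->
  forall l j x, (l <= e)%nat -> (i - Z.of_nat (S e - l) <= j <= i)%Z ->
  de_boor t (S e) c l j x - de_boor t (S e) c l (j - 1)%Z x =
  (t (j + Z.of_nat (S e - l))%Z - t j) * de_boor t e (divided_differences t e c) l j x.
Proof.
  intros Ht; induction l as [|l IH]; intros j x Hl Hj.
  - unfold divided_differences; simpl; field.
    apply (simple_knot_minus_neq_0 t i); (assumption || lia).
  - assert (diff_j := IH j x ltac:(lia) ltac:(lia)).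
    assert (diff_pred_j := IH (j - 1)%Z x ltac:(lia) ltac:(lia)).
    rewrite !de_boor_S.
    replace (S e - l)%nat with (S (e - l)) in * by lia.
    replace (S e - S l)%nat with (e - l)%nat by lia.
    replace (j - 1 + Z.of_nat (S (e - l)))%Z with (j + Z.of_nat (e - l))%Z in * by lia.
    assert (gap_j := simple_knot_minus_neq_0 t i j (j + Z.of_nat (S (e - l)))
      Ht ltac:(lia) ltac:(lia)).
    assert (gap_pred_j := simple_knot_minus_neq_0 t i (j - 1) (j + Z.of_nat (e - l))
      Ht ltac:(lia) ltac:(lia)).
    assert (gap_common := simple_knot_minus_neq_0 t i j (j + Z.of_nat (e - l))
      Ht ltac:(lia) ltac:(lia)).
    revert diff_j diff_pred_j gap_j gap_pred_j gap_common.
    generalize (de_boor t (S e) c l j x) (de_boor t (S e) c l (j - 1)%Z x)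
      (de_boor t (S e) c l (j - 1 - 1)%Z x)
      (de_boor t e (divided_differences t e c) l j x)
      (de_boor t e (divided_differences t e c) l (j - 1)%Z x)
      (t (j + Z.of_nat (S (e - l)))%Z) (t (j + Z.of_nat (e - l))%Z) (t j) (t (j - 1)%Z).
    intros d0 d1 d2 f0 f1 T1 T0 tj tj1 diff_j diff_pred_j gap_j gap_pred_j gap_common.
    replace d0 with (d1 + (T1 - tj) * f0) by lra.
    replace d2 with (d1 - (T0 - tj1) * f1) by lra.
    field; auto.
Qed.

Lemma de_boor_jump t e c i : simple_knot t i ->
  exists gamma, forall x,
    de_boor t e c e i x - de_boor t e c e (i - 1)%Z x = gamma * (x - t i) ^ e.
Proof.
  intros Ht; revert c; induction e as [|e IH]; intros c.
  - exists (c i - c (i - 1)%Z); intros x; simpl; ring.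
  - set (c' := divided_differences t e c).
    destruct (IH c') as [gamma jump]; exists gamma; intros x; specialize (jump x).
    assert (diff_i := de_boor_difference t e c i Ht e i x ltac:(lia) ltac:(lia)).
    assert (diff_pred_i := de_boor_difference t e c i Ht e (i - 1)%Z x ltac:(lia) ltac:(lia)).
    fold c' in diff_i, diff_pred_i; replace (S e - e)%nat with 1%nat in * by lia.
    rewrite !de_boor_S; replace (S e - e)%nat with 1%nat by lia.
    replace (i - 1 + Z.of_nat 1)%Z with i in * by lia.
    assert (gap_i := simple_knot_minus_neq_0 t i i (i + Z.of_nat 1) Ht ltac:(lia) ltac:(lia)).
    assert (gap_pred_i := simple_knot_minus_neq_0 t i (i - 1) i Ht ltac:(lia) ltac:(lia)).
    rewrite <- tech_pow_Rmult.
    revert jump diff_i diff_pred_i gap_i gap_pred_i.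
    generalize (de_boor t (S e) c e i x) (de_boor t (S e) c e (i - 1)%Z x)
      (de_boor t (S e) c e (i - 1 - 1)%Z x) (de_boor t e c' e i x)
      (de_boor t e c' e (i - 1)%Z x)
      (t (i + Z.of_nat 1)%Z) (t (i - 1)%Z) (t i) ((x - t i) ^ e).
    intros d0 d1 d2 f0 f1 T1 T0 ti p jump diff_i diff_pred_i gap_i gap_pred_i.
    replace d0 with (d1 + (T1 - ti) * f0) by lra.
    replace d2 with (d1 - (ti - T0) * f1) by lra.
    replace (gamma * ((x - ti) * p)) with ((x - ti) * (gamma * p)) by ring.
    rewrite <- jump; field; auto.
Qed.

(** * Blossoms and B-spline coefficients of polynomials *)

(* Polarizing a polynomial of degree [n] successively at [u_1, ..., u_n] yields the value of its
   blossom at these points. *)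
Definition polar (n : nat) (u : R) (q : R -> R) (x : R) : R :=
  q x + (u - x) * Derive q x / INR n.

Lemma is_poly_polar n u q : (1 <= n)%nat -> is_poly (S n) q -> is_poly n (polar n u q).
Proof.
  revert u q; induction n as [|n IH]; intros u q Hn Hq; [lia|].
  destruct (is_poly_horner_inv _ _ Hq) as [c [q1 [Hq1 Eq]]].
  assert (HN : INR (S n) <> 0) by (apply not_0_INR; lia).
  assert (Dq : forall x, Derive q x = q1 x + x * Derive q1 x).
  { intros x; rewrite <- (Rminus_0_r x) at 3.
    apply is_derive_unique, (is_derive_horner q q1 c); [intros v; rewrite Eq; ring|].
    now apply Derive_correct, (is_poly_ex_derive (S n)). }
  destruct n as [|n].
  - destruct (is_poly_horner_inv _ _ Hq1) as [d [q2 [Hq2 Eq2]]].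
    assert (Dq1 := is_poly_0_inv _ (is_poly_Derive_S 0 q1 Hq1)).
    apply is_poly_ext with (fun _ => c + u * d); [|apply is_poly_const].
    intros x; unfold polar; rewrite Dq, Dq1, Eq, Eq2, (is_poly_0_inv _ Hq2); simpl; field.
  - apply is_poly_ext with (fun x => (u / INR (S (S n)) * q1 x) +
      (c + x * (INR (S n) / INR (S (S n)) * polar (S n) u q1 x))).
    + intros x; unfold polar; rewrite Dq, Eq, !(S_INR (S n)).
      assert (INR (S n) <> 0) by (apply not_0_INR; lia).
      rewrite S_INR in HN.
      field; auto.
    + apply is_poly_plus; [apply is_poly_scal, Hq1|].
      apply is_poly_horner, is_poly_scal, IH; [lia | exact Hq1].
Qed.

Lemma Derive_polar n u m q x : is_poly m q -> Derive (polar n u q) x =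
  Derive q x - Derive q x / INR n + (u - x) * Derive (Derive q) x / INR n.
Proof.
  intros Hq; apply is_derive_unique; unfold polar.
  assert (Dq := is_poly_ex_derive _ _ x Hq).
  assert (DDq := is_poly_ex_derive _ _ x (is_poly_Derive _ _ Hq)).
  revert DDq; generalize (Derive q) at 1 2 4 5; intros q' Dq'.
  auto_derive; [repeat split; assumption|].
  change (Derive (fun u : R => q u) x) with (Derive q x).
  change (Derive (fun u : R => q' u) x) with (Derive q' x).
  unfold Rdiv; ring.
Qed.

Lemma polar_comm n u v m q : is_poly m q -> (1 <= n)%nat ->
  polar n u (polar (S n) v q) = polar n v (polar (S n) u q).
Proof.
  intros Hq Hn; apply functional_extensionality; intros x; unfold polar at 1 3.
  rewrite !(Derive_polar _ _ m) by exact Hq; unfold polar; rewrite S_INR.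
  assert (0 < INR n) by (apply lt_0_INR; lia).
  field; lra.
Qed.

Lemma polar_lin n u m p q a b : is_poly m p -> is_poly m q ->
  polar n u (fun x => a * p x + b * q x) = fun x => a * polar n u p x + b * polar n u q x.
Proof.
  intros Hp Hq; apply functional_extensionality; intros x; unfold polar.
  assert (Dp := is_poly_ex_derive _ _ x Hp); assert (Dq := is_poly_ex_derive _ _ x Hq).
  rewrite Derive_plus, !Derive_scal by (apply ex_derive_scal; assumption).
  unfold Rdiv; ring.
Qed.

Lemma polar_const n u c : polar n u (fun _ => c) = fun _ => c.
Proof.
  apply functional_extensionality; intros x; unfold polar.
  rewrite Derive_const; unfold Rdiv; ring.
Qed.

Lemma bounded_on_polar m K : 0 <= K -> exists C, 0 <= C /\ forall n u q a b M,
  (1 <= n)%nat -> a < b -> Rabs (u - a) <= K * (b - a) -> is_poly m q ->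
  bounded_on a b M q -> bounded_on a b (C * M) (polar n u q).
Proof.
  intros HK; destruct (is_poly_Derive_bound m 1) as [C [HC Hder]]; [lra|].
  exists (1 + (K + 1) * C); split.
  { assert (0 <= (K + 1) * C) by (apply Rmult_le_pos; lra); lra. }
  intros n u q a b M Hn Hab Hu Hq HM x Hx; unfold polar.
  assert (q_bound := HM x Hx).
  assert (q'_bound := Hder q a b M Hab Hq HM x ltac:(lra)).
  assert (ux_bound : Rabs (u - x) <= (K + 1) * (b - a)).
  { replace (u - x) with ((u - a) + - (x - a)) by ring.
    apply Rle_trans with (1 := Rabs_triang _ _).
    rewrite Rabs_Ropp, (Rabs_pos_eq (x - a)) by lra; lra. }
  assert (Hprod := Rmult_le_compat _ _ _ _ (Rabs_pos _) (Rabs_pos _) ux_bound q'_bound).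
  replace ((K + 1) * (b - a) * (C * M / (b - a))) with ((K + 1) * C * M) in Hprod
    by (field; lra).
  assert (HN : 1 <= INR n) by (apply (le_INR 1); lia).
  assert (Hinv : 0 <= / INR n <= 1).
  { split; [left; apply Rinv_0_lt_compat; lra|].
    rewrite <- Rinv_1; apply Rinv_le_contravar; lra. }
  apply Rle_trans with (1 := Rabs_triang _ _); unfold Rdiv.
  rewrite !Rabs_mult, (Rabs_pos_eq (/ INR n)) by lra.
  assert (Rabs (u - x) * Rabs (Derive q x) * / INR n <= Rabs (u - x) * Rabs (Derive q x) * 1)
    by (apply Rmult_le_compat_l; [apply Rmult_le_pos; apply Rabs_pos | lra]).
  lra.
Qed.

Fixpoint blossom (t : Z -> R) (e : nat) (q : R -> R) (s : nat) (j : Z) : R -> R :=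
  match s with
  | O => q
  | S s' => polar (e - s') (t (j + Z.of_nat (S s'))%Z) (blossom t e q s' j)
  end.

(* The j-th B-spline coefficient is the blossom at [t (j + 1), ..., t (j + e)]; the function
   [blossom t e q e j] is constant, so its value at [0] is as good as any. *)
Definition coef (t : Z -> R) (e : nat) (q : R -> R) (j : Z) : R := blossom t e q e j 0.

Lemma is_poly_blossom t e q s j : is_poly (S e) q -> (s <= e)%nat ->
  is_poly (S (e - s)) (blossom t e q s j).
Proof.
  intros Hq; induction s as [|s IH]; intros Hs; [now rewrite Nat.sub_0_r|].
  replace (S (e - S s)) with (e - s)%nat by lia.
  apply is_poly_polar; [lia | apply IH; lia].
Qed.

Lemma blossom_full t e q j x : is_poly (S e) q -> blossom t e q e j x = coef t e q j.
Proof.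
  intros Hq; assert (Hconst := is_poly_blossom t e q e j Hq (Nat.le_refl e)).
  rewrite Nat.sub_diag in Hconst.
  destruct (is_poly_horner_inv _ _ Hconst) as [c [g [Hg Eg]]].
  unfold coef; rewrite !Eg, !(is_poly_0_inv _ Hg); ring.
Qed.

Lemma blossom_pred t e q s j : is_poly (S e) q -> (s < e)%nat ->
  blossom t e q (S s) (j - 1) = polar (e - s) (t j) (blossom t e q s j).
Proof.
  intros Hq; induction s as [|s IH]; intros Hs.
  - simpl; do 2 f_equal; lia.
  - change (blossom t e q (S (S s)) (j - 1)) with
      (polar (e - S s) (t (j - 1 + Z.of_nat (S (S s)))%Z) (blossom t e q (S s) (j - 1))).
    rewrite IH by lia.
    replace (j - 1 + Z.of_nat (S (S s)))%Z with (j + Z.of_nat (S s))%Z by lia.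
    replace (e - s)%nat with (S (e - S s)) by lia.
    rewrite (polar_comm _ _ _ (S (e - s))); [| apply is_poly_blossom; [exact Hq | lia] | lia].
    replace (S (e - S s)) with (e - s)%nat by lia; reflexivity.
Qed.

Lemma coef_lin t e a p b q j : is_poly (S e) p -> is_poly (S e) q ->
  coef t e (fun x => a * p x + b * q x) j = a * coef t e p j + b * coef t e q j.
Proof.
  intros Hp Hq; unfold coef.
  assert (blossom_lin : forall s, (s <= e)%nat ->
    blossom t e (fun x => a * p x + b * q x) s j =
    fun x => a * blossom t e p s j x + b * blossom t e q s j x).
  { induction s as [|s IH]; intros Hs; [reflexivity|].
    simpl blossom; rewrite IH by lia.
    apply (polar_lin _ _ (S (e - s))); apply is_poly_blossom; (assumption || lia). }
  now rewrite blossom_lin.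
Qed.

Lemma coef_const t e c j : coef t e (fun _ => c) j = c.
Proof.
  assert (blossom_const : forall s, blossom t e (fun _ => c) s j = fun _ => c).
  { induction s as [|s IH]; [reflexivity|].
    simpl blossom; rewrite IH; apply polar_const. }
  unfold coef; now rewrite blossom_const.
Qed.

Lemma bounded_on_blossom e K s : 0 <= K -> (s <= e)%nat -> exists C, 0 <= C /\
  forall t q j a b M, a < b -> is_poly (S e) q -> bounded_on a b M q ->
  (forall i, (1 <= i <= e)%nat -> Rabs (t (j + Z.of_nat i)%Z - a) <= K * (b - a)) ->
  bounded_on a b (C * M) (blossom t e q s j).
Proof.
  intros HK; induction s as [|s IH]; intros Hs.
  - exists 1; split; [lra|]; intros t q j a b M _ _ HM _ x Hx.
    rewrite Rmult_1_l; now apply HM.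
  - destruct IH as [C [HC Hblossom]]; [lia|].
    destruct (bounded_on_polar (S (e - s)) K HK) as [C' [HC' Hpolar]].
    exists (C' * C); split; [now apply Rmult_le_pos|].
    intros t q j a b M Hab Hq HM Hknots; rewrite Rmult_assoc.
    apply Hpolar; [lia | exact Hab | apply Hknots; lia | |].
    + apply is_poly_blossom; [exact Hq | lia].
    + now apply Hblossom.
Qed.

Definition coef_constant (e : nat) (K C : R) : Prop := 0 <= C /\
  forall t q j a b M, a < b -> is_poly (S e) q -> bounded_on a b M q ->
  (forall i, (1 <= i <= e)%nat -> Rabs (t (j + Z.of_nat i)%Z - a) <= K * (b - a)) ->
  Rabs (coef t e q j) <= C * M.

Lemma coef_bound e K : 0 <= K -> exists C, coef_constant e K C.
Proof.
  intros HK; destruct (bounded_on_blossom e K e HK (Nat.le_refl e)) as [C [HC Hblossom]].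
  exists C; split; [exact HC|]; intros t q j a b M Hab Hq HM Hknots.
  rewrite <- (blossom_full t e q j a Hq).
  apply (Hblossom t q j a b M); auto; lra.
Qed.

Definition antitone (t : Z -> R) : Prop := forall a b : Z, (a <= b)%Z -> t b <= t a.

Definition active (e : nat) (i j : Z) : Prop := (i - Z.of_nat e <= j <= i)%Z.

Section KnotInterval.

Variables (t : Z -> R) (e : nat) (i : Z).
Hypotheses (t_antitone : antitone t) (interval_nonempty : t (i + 1)%Z < t i).

Lemma de_boor_gap l j : (l < e)%nat -> active (e - S l) i j ->
  t (j + Z.of_nat (e - l))%Z <= t (i + 1)%Z /\ t i <= t j.
Proof. intros Hl Hj; unfold active in Hj; split; apply t_antitone; lia. Qed.

Lemma de_boor_nonneg c x : t (i + 1)%Z <= x <= t i -> (forall j, active e i j -> 0 <= c j) ->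
  forall l j, (l <= e)%nat -> active (e - l) i j -> 0 <= de_boor t e c l j x.
Proof.
  intros Hx Hc; induction l as [|l IH]; intros j Hl Hj; simpl.
  - apply Hc; rewrite Nat.sub_0_r in Hj; exact Hj.
  - assert (gap := de_boor_gap l j Hl Hj).
    assert (left_nonneg := IH j ltac:(lia) ltac:(unfold active in *; lia)).
    assert (right_nonneg := IH (j - 1)%Z ltac:(lia) ltac:(unfold active in *; lia)).
    set (T := t (j + _)%Z) in *.
    replace (((x - t j) * de_boor t e c l j x + (T - x) * de_boor t e c l (j - 1) x) / (T - t j))
      with (((t j - x) * de_boor t e c l j x + (x - T) * de_boor t e c l (j - 1) x) / (t j - T))
      by (field; lra).
    apply Rmult_le_pos; [|left; apply Rinv_0_lt_compat; lra].
    apply Rplus_le_le_0_compat; apply Rmult_le_pos; lra.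
Qed.

Lemma de_boor_coef q l j x : is_poly (S e) q -> (l <= e)%nat -> active (e - l) i j ->
  de_boor t e (coef t e q) l j x = blossom t e q (e - l) j x.
Proof.
  intros Hq; revert j; induction l as [|l IH]; intros j Hl Hj.
  - rewrite Nat.sub_0_r; symmetry; now apply blossom_full.
  - assert (gap := de_boor_gap l j Hl Hj).
    rewrite de_boor_S, !IH by (unfold active in *; lia).
    replace (e - l)%nat with (S (e - S l)) in * by lia.
    rewrite blossom_pred by (assumption || lia).
    change (blossom t e q (S (e - S l)) j x) with
      (polar (e - (e - S l)) (t (j + Z.of_nat (S (e - S l)))%Z) (blossom t e q (e - S l) j) x).
    replace (e - (e - S l))%nat with (S l) by lia; unfold polar.
    assert (INR (S l) <> 0) by (apply not_0_INR; lia).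
    field; split; [assumption | lra].
Qed.

Lemma de_boor_reproduces q x : is_poly (S e) q -> de_boor t e (coef t e q) e i x = q x.
Proof.
  intros Hq; rewrite (de_boor_coef q e i x Hq) by (unfold active; lia).
  now rewrite Nat.sub_diag.
Qed.

Lemma de_boor_ge_poly c q sigma m x : is_poly (S e) q -> t (i + 1)%Z <= x <= t i ->
  (forall j, active e i j -> m <= sigma * (c j - coef t e q j)) ->
  m <= sigma * (de_boor t e c e i x - q x).
Proof.
  intros Hq Hx Hc.
  assert (Hm : is_poly (S e) (fun _ => m)) by apply is_poly_const.
  assert (Hdiff : 0 <= de_boor t e (fun j => 1 * (sigma * c j + - sigma * coef t e q j)
    + - 1 * coef t e (fun _ => m) j) e i x).
  { apply de_boor_nonneg; [exact Hx | | lia | unfold active; lia].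
    intros j Hj; rewrite coef_const; specialize (Hc j Hj); lra. }
  rewrite !de_boor_lin, !de_boor_reproduces in Hdiff by assumption; lra.
Qed.

Lemma de_boor_near_poly c q m x : is_poly (S e) q -> t (i + 1)%Z <= x <= t i ->
  (forall j, active e i j -> Rabs (c j - coef t e q j) <= m) ->
  Rabs (de_boor t e c e i x - q x) <= m.
Proof.
  intros Hq Hx Hc.
  assert (lower : - m <= 1 * (de_boor t e c e i x - q x)).
  { apply de_boor_ge_poly; auto; intros j Hj.
    specialize (Hc j Hj); apply Rabs_le_between in Hc; lra. }
  assert (upper : - m <= -1 * (de_boor t e c e i x - q x)).
  { apply de_boor_ge_poly; auto; intros j Hj.
    specialize (Hc j Hj); apply Rabs_le_between in Hc; lra. }
  apply Rabs_le; lra.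
Qed.

End KnotInterval.

(** * Gluing polynomials with smooth joints *)

Lemma is_derive_of_quadratic (f : R -> R) (x l : R) :
  (forall v, Rabs (f v - f x - l * (v - x)) <= (v - x) * (v - x)) -> is_derive f x l.
Proof.
  intros Hf; apply is_derive_Reals; intros eps Heps.
  exists (mkposreal eps Heps); intros h Hh0 Hh; simpl in Hh.
  replace ((f (x + h) - f x) / h - l) with ((f (x + h) - f x - l * (x + h - x)) / h)
    by (field; exact Hh0).
  unfold Rdiv; rewrite Rabs_mult, Rabs_inv.
  apply Rle_lt_trans with (2 := Hh).
  apply Rmult_le_reg_r with (Rabs h); [now apply Rabs_pos_lt|].
  rewrite Rmult_assoc, Rinv_l, Rmult_1_r by (now apply Rabs_no_R0).
  apply Rle_trans with (1 := Hf (x + h)).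
  rewrite <- Rabs_mult; apply Rle_trans with (2 := Rle_abs _); right; ring.
Qed.

Lemma Rmin_0_pow_S m u : (1 <= m)%nat -> Rmin u 0 ^ S m = u * Rmin u 0 ^ m.
Proof.
  intros Hm; unfold Rmin; destruct (Rle_dec u 0); [reflexivity|].
  rewrite !pow_i by lia; ring.
Qed.

Lemma is_derive_Rmin_0_pow n (u : R) : (2 <= n)%nat ->
  is_derive (fun u => Rmin u 0 ^ n) u (INR n * Rmin u 0 ^ (n - 1)).
Proof.
  intros Hn; induction n as [|n IH]; [lia|].
  destruct (Nat.eq_dec n 1) as [->|n_neq_1].
  - apply is_derive_of_quadratic; intros v; simpl.
    assert (0 <= (v - u) * (v - u)) by apply Rle_0_sqr.
    unfold Rmin; destruct (Rle_dec v 0) as [Hv|Hv], (Rle_dec u 0) as [Hu|Hu];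
      apply Rabs_le; try assert (u * v <= 0) by nra; split; nra.
  - apply (is_derive_ext (fun v => v * Rmin v 0 ^ n)).
    { intros v; symmetry; apply Rmin_0_pow_S; lia. }
    replace (S n - 1)%nat with n by lia.
    replace (INR (S n) * Rmin u 0 ^ n) with
      (1 * Rmin u 0 ^ n + u * (INR n * Rmin u 0 ^ (n - 1))).
    + apply (is_derive_mult (fun v => v) (fun v => Rmin v 0 ^ n));
        [apply (is_derive_id (K := R_AbsRing)) | apply IH; lia | intros; apply Rmult_comm].
    + rewrite S_INR; replace n with (S (n - 1)) at 1 5 by lia.
      rewrite Rmin_0_pow_S by lia; ring.
Qed.

Definition trunc_pow (a : R) (m : nat) (x : R) : R := Rmin (x - a) 0 ^ m.

Lemma trunc_pow_left a m x : x <= a -> trunc_pow a m x = (x - a) ^ m.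
Proof. intros Hx; unfold trunc_pow; rewrite Rmin_left by lra; reflexivity. Qed.

Lemma trunc_pow_right a m x : (1 <= m)%nat -> a <= x -> trunc_pow a m x = 0.
Proof. intros Hm Hx; unfold trunc_pow; rewrite Rmin_right by lra; apply pow_i; lia. Qed.

Lemma is_derive_trunc_pow a m (x : R) : (2 <= m)%nat ->
  is_derive (trunc_pow a m) x (INR m * trunc_pow a (m - 1) x).
Proof.
  intros Hm; replace (INR m * trunc_pow a (m - 1) x)
    with (1 * (INR m * Rmin (x - a) 0 ^ (m - 1))) by (unfold trunc_pow; ring).
  apply (is_derive_comp (fun v => Rmin v 0 ^ m) (fun u => u - a));
    [now apply is_derive_Rmin_0_pow | auto_derive; [easy | ring]].
Qed.

Lemma continuity_trunc_pow a m : continuity (trunc_pow a m).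
Proof.
  intros x; apply (continuity_pt_ext (fun u => (/ 2 * ((u - a) - Rabs (u - a))) ^ m)).
  - intros u; unfold trunc_pow; f_equal; unfold Rmin, Rabs.
    destruct (Rle_dec (u - a) 0), (Rcase_abs (u - a)); lra.
  - reg.
Qed.

Definition trunc_pow_Derive_n (a : R) (m l : nat) (x : R) : R :=
  INR (fact m) / INR (fact (m - l)) * trunc_pow a (m - l) x.

Lemma is_derive_trunc_pow_Derive_n a m l (x : R) : (S l < m)%nat ->
  is_derive (trunc_pow_Derive_n a m l) x (trunc_pow_Derive_n a m (S l) x).
Proof.
  intros Hl; unfold trunc_pow_Derive_n.
  replace (INR (fact m) / INR (fact (m - S l)) * trunc_pow a (m - S l) x)
    with (INR (fact m) / INR (fact (m - l)) * (INR (m - l) * trunc_pow a (m - l - 1) x)).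
  - apply is_derive_scal, is_derive_trunc_pow; lia.
  - replace (m - l - 1)%nat with (m - S l)%nat by lia.
    replace (m - l)%nat with (S (m - S l)) by lia.
    rewrite fact_simpl, mult_INR; field.
    split; [apply INR_fact_neq_0 | apply not_0_INR; lia].
Qed.

(* Crossing the joint [T (S i)], the pieces differ by a multiple of a full power, which the
   truncated power switches on; its derivatives of order less than [e] are continuous. *)
Lemma glue_polynomials e (p : nat -> R -> R) (T : nat -> R) m :
  (forall i, is_poly (S e) (p i)) -> (forall i j, (i <= j <= m)%nat -> T j <= T i) ->
  (forall i, (i < m)%nat -> exists gamma, forall x,
    p (S i) x = p i x + gamma * (x - T (S i)) ^ e) ->
  exists DS : nat -> R -> R,
    (forall l (x : R), (S l < e)%nat -> is_derive (DS l) x (DS (S l) x)) /\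
    (forall l, (l < e)%nat -> continuity (DS l)) /\
    (forall i l x, (i <= m)%nat -> (l < e)%nat -> x <= T i -> ((i < m)%nat -> T (S i) <= x) ->
      DS l x = Derive_n (p i) l x).
Proof.
  intros Hp; induction m as [|m IH]; intros HT Hjump.
  - exists (Derive_n (p 0%nat)); split; [|split].
    + intros l x _; apply Derive_correct, (is_poly_ex_derive (S e)), is_poly_Derive_n, Hp.
    + intros l _ x; apply continuity_pt_filterlim.
      apply (is_poly_continuous (S e)), is_poly_Derive_n, Hp.
    + intros i l x Hi _ _ _; now replace i with 0%nat by lia.
  - destruct IH as [DS [DS_derive [DS_cont DS_pieces]]];
      [intros; apply HT; lia | intros; apply Hjump; lia |].
    destruct (Hjump m ltac:(lia)) as [gamma jump].
    set (tail := trunc_pow_Derive_n (T (S m)) e).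
    exists (fun l x => DS l x + gamma * tail l x); split; [|split].
    + intros l x Hl; apply (is_derive_plus (V := R_NormedModule)); [now apply DS_derive|].
      now apply is_derive_scal, is_derive_trunc_pow_Derive_n.
    + intros l Hl; apply (continuity_plus (DS l)); [now apply DS_cont|].
      apply (continuity_scal (tail l)), (continuity_scal (trunc_pow _ _)), continuity_trunc_pow.
    + intros i l x Hi Hl HxT Hx; destruct (Nat.eq_dec i (S m)) as [->|i_neq].
      * replace (p (S m)) with (fun u => p m u + gamma * (u - T (S m)) ^ e)
          by (apply functional_extensionality; intros u; now rewrite jump).
        rewrite (is_poly_Derive_n_plus_scal (S e)), Derive_n_pow_sub
          by (apply Hp || apply is_poly_pow || lia).
        unfold tail, trunc_pow_Derive_n; rewrite trunc_pow_left by exact HxT; f_equal.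
        apply DS_pieces; [lia | exact Hl | | lia].
        apply Rle_trans with (1 := HxT), HT; lia.
      * unfold tail, trunc_pow_Derive_n; rewrite trunc_pow_right.
        -- rewrite (DS_pieces i) by (assumption || lia || (intros; apply Hx; lia)); ring.
        -- lia.
        -- apply Rle_trans with (T (S i)); [apply HT | apply Hx]; lia.
Qed.

(** * Knot sequences *)

Lemma knot_seq_lt z n : knot_seq z n -> forall a b : nat, (a < b <= n)%nat -> z b < z a.
Proof.
  intros [_ [_ z_step]] a b; induction b as [|b IH]; intros Hab; [lia|].
  assert (last_step := z_step b ltac:(lia)).
  destruct (Nat.eq_dec a b) as [->|a_neq_b]; [exact last_step|].
  apply Rlt_trans with (1 := last_step), IH; lia.
Qed.

Lemma knot_seq_pos z n : knot_seq z n -> (1 <= n)%nat.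
Proof. intros [z_0 [z_n _]]; destruct n; [lra | lia]. Qed.

Lemma zext_nat z n (i : nat) : (i <= n)%nat -> zext z n (Z.of_nat i) = z i.
Proof.
  intros Hi; unfold zext.
  destruct (Z.ltb_spec (Z.of_nat i) 0); [lia|].
  destruct (Z.ltb_spec (Z.of_nat n) (Z.of_nat i)); [lia|].
  now rewrite Nat2Z.id.
Qed.

Section ExtendedKnots.

Variables (z : nat -> R) (n : nat).
Hypothesis z_knots : knot_seq z n.

Lemma zext_low i : (i <= 0)%Z -> zext z n i = 1.
Proof.
  intros Hi; destruct (Z.eq_dec i 0) as [->|i_neq_0].
  - change 0%Z with (Z.of_nat 0); rewrite zext_nat by lia; apply z_knots.
  - unfold zext; destruct (Z.ltb_spec i 0); [reflexivity | lia].
Qed.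

Lemma zext_high i : (Z.of_nat n <= i)%Z -> zext z n i = -1.
Proof.
  intros Hi; destruct (Z.eq_dec i (Z.of_nat n)) as [->|i_neq_n].
  - rewrite zext_nat by lia; apply z_knots.
  - unfold zext; destruct (Z.ltb_spec i 0); [lia|].
    destruct (Z.ltb_spec (Z.of_nat n) i); [reflexivity | lia].
Qed.

Lemma zext_clip i : zext z n i = z (Z.to_nat (Z.max 0 (Z.min i (Z.of_nat n)))).
Proof.
  rewrite <- (zext_nat z n) by lia; rewrite Z2Nat.id by lia.
  destruct (Z_lt_le_dec i 0); [rewrite !zext_low by lia; reflexivity|].
  destruct (Z_le_gt_dec i (Z.of_nat n)); [f_equal; lia | rewrite !zext_high by lia; reflexivity].
Qed.

Lemma zext_lt a b : (a < b)%Z -> (a < Z.of_nat n)%Z -> (0 < b)%Z -> zext z n b < zext z n a.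
Proof.
  intros Hab Ha Hb; assert (n_pos := knot_seq_pos _ _ z_knots).
  rewrite !zext_clip; apply (knot_seq_lt z n z_knots); lia.
Qed.

Lemma zext_antitone : antitone (zext z n).
Proof.
  intros a b Hab; rewrite !zext_clip.
  set (i := Z.to_nat (Z.max 0 (Z.min a (Z.of_nat n)))).
  destruct (Nat.eq_dec i (Z.to_nat (Z.max 0 (Z.min b (Z.of_nat n))))) as [<-|i_neq]; [lra|].
  left; apply (knot_seq_lt z n z_knots); lia.
Qed.

Lemma zext_bounds i : -1 <= zext z n i <= 1.
Proof.
  split.
  - rewrite <- (zext_high (Z.max i (Z.of_nat n))) by lia; apply zext_antitone; lia.
  - rewrite <- (zext_low (Z.min i 0)) by lia; apply zext_antitone; lia.
Qed.

Lemma simple_knot_zext i : (0 < i < Z.of_nat n)%Z -> simple_knot (zext z n) i.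
Proof. intros Hi a b Hab Hlt; apply Rgt_not_eq, zext_lt; lia. Qed.

Lemma zext_locate x : -1 <= x <= 1 ->
  exists i, (0 <= i < Z.of_nat n)%Z /\ zext z n (i + 1) <= x <= zext z n i.
Proof.
  intros Hx; assert (n_pos := knot_seq_pos _ _ z_knots).
  assert (locate_above : forall m, (1 <= m <= n)%nat -> zext z n (Z.of_nat m) <= x ->
    exists i, (0 <= i < Z.of_nat n)%Z /\ zext z n (i + 1) <= x <= zext z n i).
  { induction m as [|m IH]; intros Hm Hzm; [lia|].
    replace (Z.of_nat (S m)) with (Z.of_nat m + 1)%Z in Hzm by lia.
    destruct (Rle_dec x (zext z n (Z.of_nat m))) as [x_le|x_gt];
      [exists (Z.of_nat m); split; [lia | lra]|].
    destruct m as [|m]; [rewrite zext_low in x_gt by lia; lra|].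
    apply IH; [lia | lra]. }
  apply (locate_above n); [lia|]; rewrite zext_high by lia; lra.
Qed.

End ExtendedKnots.

(** * Splines from B-spline coefficients *)

Lemma cont_within_of_continuous a b g (x : R) : continuous g x -> cont_within a b g x.
Proof.
  intros Cg; unfold cont_within.
  apply filterlim_filter_le_1 with (2 := Cg); apply filter_le_within.
Qed.

Lemma deriv_within_of_is_derive a b g (x l : R) : is_derive g x l -> deriv_within a b g x l.
Proof.
  intros Dg; apply is_derive_Reals in Dg.
  apply filterlim_locally; intros eps.
  destruct (Dg eps (cond_pos eps)) as [d Hd]; exists d; intros y' Hy [_ y_neq].
  set (y := y' : R); change (ball x d y) in Hy; change (y <> x) in y_neq.
  change (ball l eps ((g y - g x) / (y - x))); clearbody y; clear y'.
  specialize (Hd (y - x)); replace (x + (y - x)) with y in Hd by ring.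
  apply Hd; [lra | exact Hy].
Qed.

Lemma spline_of_coefs e z n (c : Z -> R) : (1 <= e)%nat -> knot_seq z n ->
  exists DS : nat -> R -> R,
    Sigma (S e) z n (DS 0%nat) /\ Cr_derivs (-1) 1 (e - 1) (DS 0%nat) DS /\
    forall i l x, (0 <= i < Z.of_nat n)%Z -> (l < e)%nat ->
      zext z n (i + 1) <= x <= zext z n i ->
      DS l x = Derive_n (de_boor (zext z n) e c e i) l x.
Proof.
  intros He Hz; set (t := zext z n); set (p := fun i : nat => de_boor t e c e (Z.of_nat i)).
  assert (p_poly : forall i, is_poly (S e) (p i)) by (intros i; apply is_poly_de_boor).
  destruct (glue_polynomials e p (fun i => t (Z.of_nat i)) (n - 1) p_poly)
    as [DS [DS_derive [DS_cont DS_pieces]]].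
  - intros i j Hij; apply zext_antitone; [exact Hz | lia].
  - intros i Hi.
    destruct (de_boor_jump t e c (Z.of_nat (S i))) as [gamma jump];
      [apply simple_knot_zext; [exact Hz | lia]|].
    exists gamma; intros x; specialize (jump x).
    replace (Z.of_nat (S i) - 1)%Z with (Z.of_nat i) in jump by lia.
    unfold p; lra.
  - assert (pieces : forall i l x, (0 <= i < Z.of_nat n)%Z -> (l < e)%nat ->
      t (i + 1)%Z <= x <= t i -> DS l x = Derive_n (de_boor t e c e i) l x).
    { intros i l x Hi Hl Hx; rewrite <- (Z2Nat.id i) in Hx |- * by lia.
      apply (DS_pieces (Z.to_nat i)); [lia | exact Hl | apply Hx |].
      intros _; rewrite Nat2Z.inj_succ; apply Hx. }
    assert (DS_within : forall l x, (l < e)%nat -> cont_within (-1) 1 (DS l) x).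
    { intros l x Hl; apply cont_within_of_continuous, continuity_pt_filterlim, DS_cont, Hl. }
    exists DS; split; [split|split; [split; [|split]|exact pieces]].
    + intros x _; apply DS_within; lia.
    + intros j Hj; destruct (p_poly (Nat.pred j)) as [cs [Hlen Hcs]].
      exists cs; split; [exact Hlen|]; intros x Hx; rewrite <- Hcs.
      apply (pieces (Z.of_nat (Nat.pred j)) 0%nat); [lia | lia |].
      replace (Z.of_nat (Nat.pred j) + 1)%Z with (Z.of_nat j) by lia.
      unfold t; rewrite !zext_nat by lia; exact Hx.
    + reflexivity.
    + intros l Hl x _; apply deriv_within_of_is_derive, DS_derive; lia.
    + intros x _; apply DS_within; lia.
Qed.

(** * Derivatives and moduli of smoothness on an interval *)

Definition continuous_on (a b : R) (g : R -> R) : Prop :=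
  forall x, a <= x <= b -> cont_within a b g x.

Lemma within_le {T : Type} (F : (T -> Prop) -> Prop) {FF : Filter F} (D D' : T -> Prop) :
  (forall x, D x -> D' x) -> filter_le (within D F) (within D' F).
Proof. intros Hsub P; unfold within; apply filter_imp; auto. Qed.

Lemma continuous_on_subset a' b' a b g : a' <= a -> b <= b' ->
  continuous_on a' b' g -> continuous_on a b g.
Proof.
  intros Ha Hb Cg x Hx; unfold cont_within.
  apply filterlim_filter_le_1 with (2 := Cg x ltac:(lra)).
  apply within_le; [apply locally_filter | intros u Hu; lra].
Qed.

Lemma cont_within_eps a b g x : cont_within a b g x -> forall eps, 0 < eps ->
  exists d, 0 < d /\ forall u, a <= u <= b -> Rabs (u - x) < d -> Rabs (g u - g x) < eps.
Proof.
  intros Cg eps Heps.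
  destruct (proj1 (filterlim_locally _ _) Cg (mkposreal eps Heps)) as [d Hd].
  exists d; split; [apply cond_pos|].
  intros u Hu Hux; exact (Hd u Hux Hu).
Qed.

Lemma deriv_within_eps a b g x l : deriv_within a b g x l -> forall eps, 0 < eps ->
  exists d, 0 < d /\ forall u, a <= u <= b -> u <> x -> Rabs (u - x) < d ->
    Rabs ((g u - g x) / (u - x) - l) < eps.
Proof.
  intros Dg eps Heps.
  destruct (proj1 (filterlim_locally _ _) Dg (mkposreal eps Heps)) as [d Hd].
  exists d; split; [apply cond_pos|].
  intros u Hu u_neq Hux; exact (Hd u Hux (conj Hu u_neq)).
Qed.

Lemma deriv_within_cont_within a b g x l : deriv_within a b g x l -> cont_within a b g x.
Proof.
  intros Dg; destruct (deriv_within_eps _ _ _ _ _ Dg 1 Rlt_0_1) as [d [Hd Hquot]].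
  set (L := Rabs l + 1); assert (HL : 0 < L) by (apply Rle_lt_0_plus_1, Rabs_pos).
  assert (lipschitz : forall u, a <= u <= b -> Rabs (u - x) < d ->
    Rabs (g u - g x) <= L * Rabs (u - x)).
  { intros u Hu Hux; destruct (Req_dec u x) as [->|u_neq];
      [rewrite !Rminus_diag, Rabs_R0; lra|].
    replace (g u - g x) with (((g u - g x) / (u - x) - l + l) * (u - x)) by (field; lra).
    rewrite Rabs_mult; apply Rmult_le_compat_r; [apply Rabs_pos|].
    apply Rle_trans with (1 := Rabs_triang _ _).
    specialize (Hquot u Hu u_neq Hux); unfold L; lra. }
  apply filterlim_locally; intros eps.
  assert (Heps : 0 < eps / L) by (apply Rdiv_lt_0_compat; [apply cond_pos | exact HL]).
  exists (mkposreal _ (Rmin_pos _ _ Hd Heps)); intros u Hux Hu; apply Rmin_Rgt_l in Hux.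
  apply Rle_lt_trans with (1 := lipschitz u Hu (proj1 Hux)).
  replace (pos eps) with (L * (eps / L)) by (field; lra).
  apply Rmult_lt_compat_l; [exact HL | apply Hux].
Qed.

Lemma deriv_within_is_derive a b g x l : a < x < b -> deriv_within a b g x l ->
  is_derive g x l.
Proof.
  intros Hx Dg; apply is_derive_Reals; intros eps Heps.
  destruct (deriv_within_eps _ _ _ _ _ Dg eps Heps) as [d [Hd Hquot]].
  assert (Hside : 0 < Rmin (x - a) (b - x)) by (apply Rmin_pos; lra).
  exists (mkposreal _ (Rmin_pos _ _ Hd Hside)); intros h h_neq Hh.
  apply Rmin_Rgt_l in Hh; destruct Hh as [h_lt_d h_lt_side].
  apply Rmin_Rgt_l in h_lt_side; destruct h_lt_side as [h_left h_right].
  apply Rabs_def2 in h_left; apply Rabs_def2 in h_right.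
  specialize (Hquot (x + h)); replace (x + h - x) with h in Hquot by ring.
  apply Hquot; [lra | lra | exact h_lt_d].
Qed.

Lemma Cr_derivs_subset a' b' a b r f Df : a' <= a -> b <= b' ->
  Cr_derivs a' b' r f Df -> Cr_derivs a b r f Df.
Proof.
  intros Ha Hb [Df_0 [Df_S Df_r]]; split; [|split].
  - intros x Hx; apply Df_0; lra.
  - intros i Hi x Hx; apply filterlim_filter_le_1 with (2 := Df_S i Hi x ltac:(lra)).
    apply within_le; [apply locally_filter | intros u Hu; lra].
  - now apply (continuous_on_subset a' b').
Qed.

Lemma Cr_derivs_continuous_on a b r f Df i : Cr_derivs a b r f Df -> (i <= r)%nat ->
  continuous_on a b (Df i).
Proof.
  intros [_ [Df_S Df_r]] Hi x Hx; destruct (Nat.eq_dec i r) as [->|i_neq_r]; [now apply Df_r|].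
  apply deriv_within_cont_within with (Df (S i) x), Df_S; [lia | exact Hx].
Qed.

Definition clamp (a b x : R) : R := Rmax a (Rmin x b).

Lemma clamp_bounds a b x : a <= b -> a <= clamp a b x <= b.
Proof. unfold clamp, Rmax, Rmin; destruct (Rle_dec x b), (Rle_dec _ _); lra. Qed.

Lemma clamp_id a b x : a <= x <= b -> clamp a b x = x.
Proof. intros Hx; unfold clamp; rewrite Rmin_left, Rmax_right; lra. Qed.

Lemma clamp_lipschitz a b x y : a <= b -> Rabs (clamp a b y - clamp a b x) <= Rabs (y - x).
Proof.
  intros Hab; unfold clamp, Rmax, Rmin.
  destruct (Rle_dec x b), (Rle_dec y b); repeat destruct (Rle_dec _ _);
    apply Rabs_le; unfold Rabs; destruct (Rcase_abs (y - x)); lra.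
Qed.

Lemma continuity_clamp a b g : a <= b -> continuous_on a b g ->
  continuity (fun x => g (clamp a b x)).
Proof.
  intros Hab Cg x; apply continuity_pt_filterlim, filterlim_locally; intros eps.
  destruct (cont_within_eps _ _ _ _ (Cg (clamp a b x) (clamp_bounds a b x Hab)) eps (cond_pos eps))
    as [d [Hd Hg]].
  exists (mkposreal d Hd); intros u Hu.
  apply Hg; [now apply clamp_bounds|].
  apply Rle_lt_trans with (1 := clamp_lipschitz a b x u Hab), Hu.
Qed.

Lemma is_derive_clamp a b g x l : a < x < b -> deriv_within a b g x l ->
  is_derive (fun u => g (clamp a b u)) x l.
Proof.
  intros Hx Dg; apply (is_derive_ext_loc (K := R_AbsRing) (V := R_NormedModule) g).
  - apply (locally_interval _ x a b); [apply Hx | apply Hx |].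
    intros u Hau Hub; simpl in *; rewrite clamp_id; [reflexivity | lra].
  - now apply deriv_within_is_derive with a b.
Qed.

Lemma continuous_on_bounded a b g : a <= b -> continuous_on a b g ->
  exists B, bounded_on a b B g.
Proof.
  intros Hab Cg; assert (C := continuity_clamp a b g Hab Cg).
  destruct (continuity_ab_maj (fun x => g (clamp a b x)) a b Hab (fun x _ => C x))
    as [u [Hu _]].
  destruct (continuity_ab_min (fun x => g (clamp a b x)) a b Hab (fun x _ => C x))
    as [v [Hv _]].
  exists (Rmax (g (clamp a b u)) (- g (clamp a b v))); intros x Hx.
  specialize (Hu x Hx); specialize (Hv x Hx); rewrite (clamp_id a b x Hx) in Hu, Hv.
  assert (u_le := Rmax_l (g (clamp a b u)) (- g (clamp a b v))).
  assert (v_le := Rmax_r (g (clamp a b u)) (- g (clamp a b v))).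
  apply Rabs_le; lra.
Qed.

Lemma fdiff_nodes k h x a b l : 0 < h -> a <= x -> x + INR k * h <= b -> (l <= k)%nat ->
  a <= x + INR l * h <= b.
Proof.
  intros Hh Ha Hb Hl.
  assert (0 <= INR l <= INR k) by (split; [apply pos_INR | now apply le_INR]).
  nra.
Qed.

Lemma fdiff_bounded_ext k a b W f g : (forall x, a <= x <= b -> f x = g x) ->
  fdiff_bounded k a b W f -> fdiff_bounded k a b W g.
Proof.
  intros Hfg HW h x Hh Hx Hxh; replace (fdiff k h g x) with (fdiff k h f x); [now apply HW|].
  apply sum_eq; intros l Hl; rewrite Hfg; [reflexivity | now apply (fdiff_nodes k)].
Qed.

Lemma bounded_on_fdiff_bounded k a b B g : bounded_on a b B g ->
  exists W, fdiff_bounded k a b W g.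
Proof.
  intros HB; exists (sum_f_R0 (fun l => Rabs (binomial_weight k l) * B) k).
  intros h x Hh Hx Hxh; apply Rle_trans with (1 := Rsum_abs _ _).
  apply sum_Rle; intros l Hl; rewrite Rabs_mult.
  apply Rmult_le_compat_l; [apply Rabs_pos|].
  apply HB; now apply (fdiff_nodes k).
Qed.

Section ModulusOfSmoothness.

Variables (k : nat) (g : R -> R) (a b : R).
Hypotheses (k_pos : (1 <= k)%nat) (a_lt_b : a < b) (g_cont : continuous_on a b g).

Lemma omega_is_lub : is_lub_Rbar (fun v => exists h x, 0 < h <= b - a /\ a <= x /\
  x + INR k * h <= b /\ v = Rabs (fdiff k h g x)) (omega k g (b - a) a b).
Proof.
  unfold omega; set (E := fun v => _).
  assert (Hlub := Lub_Rbar_correct E).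
  assert (HK : 1 <= INR k) by (apply (le_INR 1); exact k_pos).
  assert (E_inhabited : exists v, E v).
  { set (h := (b - a) / INR k); exists (Rabs (fdiff k h g a)), h, a.
    assert (k_steps : INR k * h = b - a) by (unfold h; field; lra).
    assert (Hh : 0 < h) by (apply Rdiv_lt_0_compat; lra).
    assert (h <= INR k * h) by nra.
    repeat split; lra. }
  assert (E_bounded : exists W, is_ub_Rbar E (Finite W)).
  { destruct (continuous_on_bounded a b g) as [B HB]; [lra | exact g_cont |].
    destruct (bounded_on_fdiff_bounded k a b B g HB) as [W HW].
    exists W; intros v [h [x [Hh [Hx [Hxh ->]]]]]; apply HW; lra. }
  destruct E_inhabited as [v Hv]; destruct E_bounded as [W HW].
  assert (below_W := proj2 Hlub _ HW); assert (above_v := proj1 Hlub _ Hv).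
  destruct (Lub_Rbar E) as [L| |]; simpl in *; [exact Hlub | contradiction | contradiction].
Qed.

Lemma fdiff_bounded_omega : fdiff_bounded k a b (omega k g (b - a) a b) g.
Proof.
  intros h x Hh Hx Hxh; assert (HK : 1 <= INR k) by (apply (le_INR 1); exact k_pos).
  assert (h <= INR k * h) by nra.
  apply (proj1 omega_is_lub); exists h, x; repeat split; lra.
Qed.

Lemma omega_le W : fdiff_bounded k a b W g -> omega k g (b - a) a b <= W.
Proof.
  intros HW; apply (proj2 omega_is_lub (Finite W)).
  intros v [h [x [Hh [Hx [Hxh ->]]]]]; apply HW; lra.
Qed.

Lemma omega_nonneg : 0 <= omega k g (b - a) a b.
Proof. apply (fdiff_bounded_nonneg k a b _ g k_pos a_lt_b fdiff_bounded_omega). Qed.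

End ModulusOfSmoothness.

Lemma omega_mono k g a b a' b' : (1 <= k)%nat -> a' <= a -> a < b -> b <= b' ->
  continuous_on a' b' g -> omega k g (b - a) a b <= omega k g (b' - a') a' b'.
Proof.
  intros Hk Ha Hab Hb Cg; apply omega_le; [exact Hk | exact Hab | |].
  - now apply (continuous_on_subset a' b').
  - intros h x Hh Hx Hxh.
    apply (fdiff_bounded_omega k g a' b'); (assumption || lra).
Qed.

Definition local_error (C : R) (k r : nat) (g : R -> R) (a b : R) : R :=
  C * (b - a) ^ r * omega k g (b - a) a b.

Lemma local_error_nonneg C k r g a b : 0 <= C -> (1 <= k)%nat -> a < b ->
  continuous_on a b g -> 0 <= local_error C k r g a b.
Proof.
  intros HC Hk Hab Cg; apply Rmult_le_pos; [|now apply omega_nonneg].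
  apply Rmult_le_pos; [exact HC | apply pow_le; lra].
Qed.

Lemma local_error_mono C k r g a b a' b' : 0 <= C -> (1 <= k)%nat ->
  a' <= a -> a < b -> b <= b' -> continuous_on a' b' g ->
  local_error C k r g a b <= local_error C k r g a' b'.
Proof.
  intros HC Hk Ha Hab Hb Cg; apply Rmult_le_compat.
  - apply Rmult_le_pos; [exact HC | apply pow_le; lra].
  - apply omega_nonneg; auto; now apply (continuous_on_subset a' b').
  - apply Rmult_le_compat_l; [exact HC|]; apply pow_incr; lra.
  - now apply omega_mono.
Qed.

(** * One-sided Hermite approximation *)

Lemma hermite_whitney k r : (1 <= k)%nat -> exists C, 0 <= C /\ forall f Df a b tau,
  Cr_derivs a b r f Df -> a < b -> a <= tau <= b ->
  exists P, is_poly (k + r) P /\ osculates r tau Df P /\ forall x, a <= x <= b ->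
    Rabs (f x - P x) <= C * omega k (Df r) (b - a) a b * Rabs (x - tau) ^ r.
Proof.
  intros Hk; destruct (whitney k Hk) as [C [HC Hwhitney]].
  exists C; split; [exact HC|]; intros f Df a b tau Hf Hab Htau.
  assert (Cf := fun i => Cr_derivs_continuous_on a b r f Df i Hf).
  assert (Cclamp : forall i, (i <= r)%nat -> continuity (fun x => Df i (clamp a b x)))
    by (intros i Hi; apply continuity_clamp; [lra | now apply Cf]).
  destruct (Hwhitney (fun x => Df r (clamp a b x)) a b (omega k (Df r) (b - a) a b))
    as [Q [HQ nearQ]]; auto.
  { apply fdiff_bounded_ext with (Df r); [intros x Hx; now rewrite clamp_id|].
    apply fdiff_bounded_omega; auto. }
  destruct (osculating_poly_approx r k (fun i x => Df i (clamp a b x)) a b tau Q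
    (C * omega k (Df r) (b - a) a b)) as [P [HP [oscP nearP]]]; auto.
  - intros i x Hi Hx; apply is_derive_clamp; [exact Hx|].
    rewrite clamp_id by lra; apply Hf; [exact Hi | lra].
  - apply Rmult_le_pos; [exact HC | apply omega_nonneg; auto].
  - exists P; split; [exact HP|]; split.
    + intros l Hl; rewrite oscP, clamp_id by assumption; reflexivity.
    + intros x Hx; specialize (nearP x Hx); rewrite clamp_id in nearP by exact Hx.
      now rewrite <- (proj1 Hf).
Qed.

Lemma Rabs_1_sqr sg : Rabs sg = 1 -> sg * sg = 1.
Proof.
  intros Hsg; rewrite <- (Rabs_pos_eq (sg * sg)) by apply Rle_0_sqr.
  rewrite Rabs_mult, Hsg; ring.
Qed.

Lemma one_sided_correction f P a b tau K q sg : 0 <= K -> Rabs sg = 1 ->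
  (forall x, a <= x <= b -> Rabs (f x - P x) <= K * Rabs (x - tau) ^ q) ->
  let P' := fun x => P x + sg * K * (x - tau) ^ q in
  (forall x, a <= x <= b -> Rabs (f x - P' x) <= 2 * (K * Rabs (x - tau) ^ q)) /\
  (forall x, a <= x <= b -> tau <= x -> 0 <= sg * (P' x - f x)) /\
  (forall x, a <= x <= b -> x <= tau -> 0 <= (-1) ^ q * sg * (P' x - f x)).
Proof.
  intros HK Hsg nearP P'; unfold P'; assert (Hsg2 := Rabs_1_sqr sg Hsg).
  assert (below_abs : forall s v, Rabs s = 1 -> s * v <= Rabs v).
  { intros s v Hs; apply Rle_trans with (1 := Rle_abs _); rewrite Rabs_mult, Hs; lra. }
  split; [|split]; intros x Hx; specialize (nearP x Hx).
  - replace (f x - (P x + sg * K * (x - tau) ^ q))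
      with ((f x - P x) + - (sg * (K * (x - tau) ^ q))) by ring.
    apply Rle_trans with (1 := Rabs_triang _ _).
    rewrite Rabs_Ropp, !Rabs_mult, Hsg, <- RPow_abs, (Rabs_pos_eq K) by exact HK; lra.
  - intros Hxt; rewrite (Rabs_pos_eq (x - tau)) in nearP by lra.
    replace (sg * (P x + sg * K * (x - tau) ^ q - f x))
      with ((sg * sg) * (K * (x - tau) ^ q) - sg * (f x - P x)) by ring.
    specialize (below_abs sg (f x - P x) Hsg); rewrite Hsg2; lra.
  - intros Hxt; rewrite (Rabs_left1 (x - tau)) in nearP by lra.
    replace (- (x - tau)) with (-1 * (x - tau)) in nearP by ring.
    rewrite Rpow_mult_distr in nearP.
    replace ((-1) ^ q * sg * (P x + sg * K * (x - tau) ^ q - f x)) with ((sg * sg) *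
      (K * ((-1) ^ q * (x - tau) ^ q)) - ((-1) ^ q * sg) * (f x - P x)) by ring.
    assert (Hs : Rabs ((-1) ^ q * sg) = 1) by (rewrite Rabs_mult, pow_1_abs, Hsg; ring).
    specialize (below_abs _ (f x - P x) Hs); rewrite Hsg2; lra.
Qed.

Definition hermite_constant (k r : nat) (C : R) : Prop := 0 <= C /\
  forall f Df a b tau q sg, Cr_derivs a b r f Df -> a < b -> a <= tau <= b ->
  (q <= r)%nat -> Rabs sg = 1 ->
  exists P, is_poly (k + r) P /\ osculates q tau Df P /\
    bounded_on a b (local_error C k r (Df r) a b) (fun x => f x - P x) /\
    (forall x, a <= x <= b -> tau <= x -> 0 <= sg * (P x - f x)) /\
    (forall x, a <= x <= b -> x <= tau -> 0 <= (-1) ^ q * sg * (P x - f x)).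

Lemma one_sided_hermite k r : (1 <= k)%nat -> exists C, hermite_constant k r C.
Proof.
  intros Hk; destruct (hermite_whitney k r Hk) as [C [HC Hhermite]].
  exists (2 * C); split; [lra|]; intros f Df a b tau q sg Hf Hab Htau Hq Hsg.
  destruct (Hhermite f Df a b tau Hf Hab Htau) as [P [HP [oscP nearP]]].
  set (om := omega k (Df r) (b - a) a b) in *.
  assert (Hom : 0 <= om) by (apply omega_nonneg; auto; now apply (Cr_derivs_continuous_on a b r f)).
  set (K := C * om * (b - a) ^ (r - q)).
  assert (HCom : 0 <= C * om) by (now apply Rmult_le_pos).
  assert (HK : 0 <= K) by (apply Rmult_le_pos; [exact HCom | apply pow_le; lra]).
  assert (pow_split : forall u, (u ^ r)%R = u ^ (r - q) * u ^ q)
    by (intros u; rewrite <- pow_add; f_equal; lia).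
  assert (x_near : forall x, a <= x <= b -> 0 <= Rabs (x - tau) <= b - a)
    by (intros x Hx; split; [apply Rabs_pos | apply Rabs_le; lra]).
  destruct (one_sided_correction f P a b tau K q sg HK Hsg) as [near [right_side left_side]].
  { intros x Hx; apply Rle_trans with (1 := nearP x Hx).
    rewrite pow_split, <- Rmult_assoc; apply Rmult_le_compat_r; [apply pow_le, Rabs_pos|].
    apply Rmult_le_compat_l; [exact HCom | now apply pow_incr, x_near]. }
  assert (pow_poly : is_poly (k + r) (fun x => (x - tau) ^ q))
    by (apply is_poly_le with (S q); [lia | apply is_poly_pow]).
  exists (fun x => P x + sg * K * (x - tau) ^ q); split; [|split; [|split; [|split]]]; auto.
  - now apply is_poly_plus, is_poly_scal.
  - intros l Hl.
    rewrite (is_poly_Derive_n_plus_scal (k + r)), Derive_n_pow_sub by (assumption || lia).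
    rewrite Rminus_diag, pow_i, oscP by lia; ring.
  - intros x Hx; apply Rle_trans with (1 := near x Hx).
    unfold local_error; fold om; rewrite (pow_split (b - a)).
    replace (2 * C * ((b - a) ^ (r - q) * (b - a) ^ q) * om)
      with (2 * (K * (b - a) ^ q)) by (unfold K; ring).
    apply Rmult_le_compat_l; [lra|]; apply Rmult_le_compat_l; [exact HK|].
    now apply pow_incr, x_near.
Qed.

(** * Lengths of knot windows *)

Lemma fold_right_Rmax_ge (l : list R) v : In v l -> v <= fold_right Rmax 0 l.
Proof.
  induction l as [|a l IH]; [easy|].
  intros [->|Hv]; simpl; [apply Rmax_l|].
  apply Rle_trans with (1 := IH Hv), Rmax_r.
Qed.

Definition window_ratio (N : nat) (rho : R) : R := INR (2 * N + 1) * Rmax 1 rho ^ N.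

Lemma window_ratio_nonneg N rho : 0 <= window_ratio N rho.
Proof.
  assert (ratio_ge_1 := Rmax_l 1 rho).
  apply Rmult_le_pos; [apply pos_INR | apply pow_le; lra].
Qed.

(* The closed support of the j-th B-spline of degree [e] contains [v]. *)
Definition touches (t : Z -> R) (e : nat) (j : Z) (v : R) : Prop :=
  t (j + Z.of_nat e + 1)%Z <= v <= t j.

Section KnotWindows.

Variables (z : nat -> R) (n : nat).
Hypothesis z_knots : knot_seq z n.

Lemma Jlen_pos i : (1 <= i <= Z.of_nat n)%Z -> 0 < Jlen z n i.
Proof.
  intros Hi; unfold Jlen.
  assert (zext z n i < zext z n (i - 1)) by (apply zext_lt; (assumption || lia)); lra.
Qed.

Lemma Jlen_outside i : ~ (1 <= i <= Z.of_nat n)%Z -> Jlen z n i = 0.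
Proof.
  intros Hi; unfold Jlen; destruct (Z_le_gt_dec i 0).
  - rewrite !zext_low by (assumption || lia); ring.
  - rewrite !zext_high by (assumption || lia); ring.
Qed.

Lemma Jlen_nonneg i : 0 <= Jlen z n i.
Proof.
  assert (ends := zext_antitone z n z_knots (i - 1)%Z i ltac:(lia)); unfold Jlen; lra.
Qed.

Lemma Jlen_neighbours i : (1 <= i <= Z.of_nat n)%Z ->
  Jlen z n (i - 1) <= rho z n * Jlen z n i /\ Jlen z n (i + 1) <= rho z n * Jlen z n i.
Proof.
  intros Hi; assert (J_pos := Jlen_pos i Hi).
  assert (ratios_le : Rmax (Jlen z n (i - 1) / Jlen z n i) (Jlen z n (i + 1) / Jlen z n i)
    <= rho z n).
  { apply fold_right_Rmax_ge, in_map_iff; exists (Z.to_nat i); split; [|apply in_seq; lia].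
    cbv zeta; rewrite Z2Nat.id by lia; reflexivity. }
  assert (left_ratio := Rle_trans _ _ _ (Rmax_l _ _) ratios_le).
  assert (right_ratio := Rle_trans _ _ _ (Rmax_r _ _) ratios_le).
  split; apply Rmult_le_reg_r with (/ Jlen z n i); try (now apply Rinv_0_lt_compat);
    rewrite (Rmult_assoc (rho z n)), Rinv_r, Rmult_1_r by lra; assumption.
Qed.

Lemma Jlen_geometric i j : (1 <= i <= Z.of_nat n)%Z ->
  Jlen z n j <= Rmax 1 (rho z n) ^ Z.abs_nat (j - i) * Jlen z n i.
Proof.
  intros Hi; set (q := Rmax 1 (rho z n)).
  assert (q_ge_1 : 1 <= q) by apply Rmax_l; assert (q_ge_rho : rho z n <= q) by apply Rmax_r.
  remember (Z.abs_nat (j - i)) as m eqn:Em; revert j Em; induction m as [|m IH]; intros j Em.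
  - replace j with i by lia; simpl; lra.
  - destruct (classic (1 <= j <= Z.of_nat n)%Z) as [Hj|Hj].
    2:{ rewrite Jlen_outside by exact Hj.
        apply Rmult_le_pos; [apply pow_le; lra | apply Jlen_nonneg]. }
    assert (closer : exists j', Jlen z n j <= rho z n * Jlen z n j' /\ m = Z.abs_nat (j' - i)).
    { destruct (Z_lt_le_dec j i); [exists (j + 1)%Z | exists (j - 1)%Z]; (split; [|lia]).
      - replace j with (j + 1 - 1)%Z at 1 by lia; apply Jlen_neighbours; lia.
      - replace j with (j - 1 + 1)%Z at 1 by lia; apply Jlen_neighbours; lia. }
    destruct closer as [j' [ratio Em']]; specialize (IH j' Em').
    apply Rle_trans with (1 := ratio), Rle_trans with (q * Jlen z n j').
    + apply Rmult_le_compat_r; [apply Jlen_nonneg | exact q_ge_rho].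
    + simpl; rewrite Rmult_assoc; apply Rmult_le_compat_l; lra.
Qed.

Lemma zext_window_le i N : (1 <= i <= Z.of_nat n)%Z ->
  zext z n (i - 1 - Z.of_nat N) - zext z n (i + Z.of_nat N) <=
  window_ratio N (rho z n) * Jlen z n i.
Proof.
  intros Hi; unfold window_ratio; set (q := Rmax 1 (rho z n)).
  assert (q_ge_1 : 1 <= q) by apply Rmax_l.
  assert (J_le : forall j, (Z.abs (j - i) <= Z.of_nat N)%Z -> Jlen z n j <= q ^ N * Jlen z n i).
  { intros j Hj; apply Rle_trans with (1 := Jlen_geometric i j Hi).
    apply Rmult_le_compat_r; [apply Jlen_nonneg | apply Rle_pow; [exact q_ge_1 | lia]]. }
  assert (partial : forall m, (m <= N)%nat ->
    zext z n (i - 1 - Z.of_nat m) - zext z n (i + Z.of_nat m) <=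
    INR (2 * m + 1) * (q ^ N * Jlen z n i)).
  { induction m as [|m IH]; intros Hm.
    - assert (J_i := J_le i ltac:(lia)); unfold Jlen in J_i at 1.
      simpl Z.of_nat; rewrite Z.sub_0_r, Z.add_0_r; simpl; lra.
    - assert (J_right := J_le (i + Z.of_nat (S m))%Z ltac:(lia)).
      assert (J_left := J_le (i - Z.of_nat (S m))%Z ltac:(lia)).
      specialize (IH ltac:(lia)); unfold Jlen in J_left at 1; unfold Jlen in J_right at 1.
      replace (i + Z.of_nat (S m) - 1)%Z with (i + Z.of_nat m)%Z in J_right by lia.
      replace (i - Z.of_nat (S m))%Z with (i - 1 - Z.of_nat m)%Z in J_left by lia.
      replace (i - 1 - Z.of_nat m - 1)%Z with (i - 1 - Z.of_nat (S m))%Z in J_left by lia.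
      replace (2 * S m + 1)%nat with (S (S (2 * m + 1))) by lia; rewrite !S_INR; lra. }
  rewrite Rmult_assoc; now apply partial.
Qed.

Lemma knots_in_le a b i m : zext z n (i + 1 + Z.of_nat m) <= a -> b <= zext z n i ->
  (knots_in z n a b <= m)%nat.
Proof.
  intros Ha Hb; unfold knots_in; set (inside := fun j => _).
  rewrite <- (length_seq m (Z.to_nat (i + 1))).
  apply NoDup_incl_length; [apply NoDup_filter, seq_NoDup|].
  intros j Hj; apply filter_In in Hj; destruct Hj as [Hj j_inside]; apply in_seq in Hj.
  unfold inside in j_inside; destruct (Rlt_dec a (z j)) as [a_lt|]; [|easy].
  destruct (Rlt_dec (z j) b) as [lt_b|]; [|easy].
  rewrite <- (zext_nat z n j) in a_lt, lt_b by lia.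
  assert (i < Z.of_nat j)%Z.
  { apply Z.nle_gt; intros Hle; apply (zext_antitone z n z_knots) in Hle; lra. }
  assert (Z.of_nat j < i + 1 + Z.of_nat m)%Z.
  { apply Z.nle_gt; intros Hle; apply (zext_antitone z n z_knots) in Hle; lra. }
  apply in_seq; lia.
Qed.

Lemma zext_interval_lt i : (0 <= i < Z.of_nat n)%Z -> zext z n (i + 1) < zext z n i.
Proof. intros Hi; apply zext_lt; (assumption || lia). Qed.

Lemma active_range e i j : (0 <= i < Z.of_nat n)%Z -> active e i j ->
  (- Z.of_nat e <= j < Z.of_nat n)%Z.
Proof. unfold active; lia. Qed.

Lemma active_touches e i j x : active e i j -> zext z n (i + 1) <= x <= zext z n i ->
  touches (zext z n) e j x.
Proof.
  unfold active, touches; intros Hj Hx.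
  assert (zext z n (j + Z.of_nat e + 1) <= zext z n (i + 1))
    by (apply zext_antitone; (assumption || lia)).
  assert (zext z n i <= zext z n j) by (apply zext_antitone; (assumption || lia)).
  lra.
Qed.

Lemma touches_range e i j v : (0 <= i < Z.of_nat n)%Z -> (- Z.of_nat e <= j < Z.of_nat n)%Z ->
  touches (zext z n) e j v -> zext z n (i + 1) <= v <= zext z n i ->
  (i - Z.of_nat e - 1 <= j <= i + 1)%Z.
Proof.
  intros Hi Hj [v_ge v_le] Hv; split; apply Z.nlt_ge; intros Hlt.
  - assert (zext z n i < zext z n (j + Z.of_nat e + 1)) by (apply zext_lt; (assumption || lia)).
    lra.
  - assert (zext z n j < zext z n (i + 1)) by (apply zext_lt; (assumption || lia)); lra.
Qed.

Lemma coef_le_on_interval e C i j q M : coef_constant e (window_ratio e (rho z n)) C ->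
  (0 <= i < Z.of_nat n)%Z -> active e i j -> is_poly (S e) q ->
  bounded_on (zext z n (i + 1)) (zext z n i) M q -> Rabs (coef (zext z n) e q j) <= C * M.
Proof.
  unfold active; intros C_constant Hi Hj Hq HM.
  apply (proj2 C_constant (zext z n) q j (zext z n (i + 1)) (zext z n i));
    [now apply zext_interval_lt | exact Hq | exact HM |].
  intros m Hm; assert (window := zext_window_le (i + 1) e ltac:(lia)).
  unfold Jlen in window; replace (i + 1 - 1)%Z with i in window by lia.
  assert (Ht := zext_antitone z n z_knots).
  assert (zext z n (j + Z.of_nat m) <= zext z n (i - Z.of_nat e)) by (apply Ht; lia).
  assert (zext z n (i + 1 + Z.of_nat e) <= zext z n (j + Z.of_nat m)) by (apply Ht; lia).
  assert (zext z n (i + 1 + Z.of_nat e) <= zext z n (i + 1)) by (apply Ht; lia).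
  assert (zext z n (i + 1) <= zext z n (i - Z.of_nat e)) by (apply Ht; lia).
  apply Rabs_le; lra.
Qed.

End KnotWindows.

(** * Breakpoints and signs *)

Definition listed (u : nat -> R) (m : nat) (v : R) : Prop :=
  exists i : nat, (1 <= i <= m)%nat /\ v = u i.

Definition breakpoint (y : nat -> R) (s : nat) (alpha : nat -> R) (p : nat) (v : R) : Prop :=
  v = 1 \/ v = -1 \/ listed y s v \/ listed alpha p v.

Lemma list_next (l : list R) x b : x < b ->
  exists c, (c = b \/ In c l) /\ x < c <= b /\ forall v, In v l -> ~ (x < v < c).
Proof.
  intros Hxb; induction l as [|a l [c [c_in [Hc no_between]]]].
  - exists b; repeat split; auto; lra.
  - destruct (Rlt_dec x a) as [x_lt_a|x_ge_a]; [destruct (Rlt_dec a c) as [a_lt_c|a_ge_c]|].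
    + exists a; split; [right; now left|]; split; [lra|].
      intros v [->|v_in]; [lra|]; specialize (no_between v v_in); lra.
    + exists c; split; [destruct c_in; auto; right; now right|]; split; [exact Hc|].
      intros v [->|v_in]; [lra | auto].
    + exists c; split; [destruct c_in; auto; right; now right|]; split; [exact Hc|].
      intros v [->|v_in]; [lra | auto].
Qed.

Lemma breakpoint_next y s alpha p v w : breakpoint y s alpha p w -> v < w ->
  exists b, breakpoint y s alpha p b /\ v < b <= w /\
    forall u, breakpoint y s alpha p u -> ~ (v < u < b).
Proof.
  intros Hw Hvw; set (l := 1 :: -1 :: map y (seq 1 s) ++ map alpha (seq 1 p)).
  assert (listed_map : forall u m x, listed u m x <-> In x (map u (seq 1 m))).
  { intros u m x; rewrite in_map_iff; split.
    - intros [i [Hi ->]]; exists i; split; [reflexivity | apply in_seq; lia].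
    - intros [i [<- Hi]]; apply in_seq in Hi; exists i; split; [lia | reflexivity]. }
  assert (breakpoint_list : forall u, breakpoint y s alpha p u <-> In u l).
  { intros u; unfold breakpoint, l; simpl; rewrite in_app_iff, !listed_map.
    split; intros Hu; decompose [or] Hu; subst; auto. }
  destruct (list_next l v w Hvw) as [b [b_in [Hb no_between]]].
  exists b; split; [|split; [exact Hb | intros u Hu; apply no_between, breakpoint_list, Hu]].
  destruct b_in as [->|b_in]; [exact Hw | now apply breakpoint_list].
Qed.

Definition knots_separate (B : R -> Prop) (z : nat -> R) (n N : nat) : Prop :=
  forall a b : R, B a -> B b -> a < b -> (forall v, B v -> ~ (a < v < b)) ->
    (N <= knots_in z n a b)%nat.

Lemma touched_breakpoint_unique z n N e y s alpha p : knot_seq z n ->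
  knots_separate (breakpoint y s alpha p) z n N -> (2 * e < N)%nat ->
  forall j j' v v', breakpoint y s alpha p v -> breakpoint y s alpha p v' ->
    touches (zext z n) e j v -> touches (zext z n) e j' v' ->
    (Z.abs (j - j') <= Z.of_nat e)%Z -> v = v'.
Proof.
  intros Hz separated HN.
  assert (not_lt : forall j j' v v', breakpoint y s alpha p v -> breakpoint y s alpha p v' ->
    touches (zext z n) e j v -> touches (zext z n) e j' v' ->
    (Z.abs (j - j') <= Z.of_nat e)%Z -> ~ v' < v).
  { intros j j' v v' Hv Hv' [_ v_le] [v'_ge _] Hjj Hlt.
    destruct (breakpoint_next y s alpha p v' v Hv Hlt) as [b [Hb [Hvb no_between]]].
    assert (many := separated v' b Hv' Hb ltac:(lra) no_between).
    assert (few : (knots_in z n v' b <= 2 * e)%nat).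
    { apply (knots_in_le z n Hz v' b j); [|lra].
      apply Rle_trans with (2 := v'_ge), zext_antitone; [exact Hz | lia]. }
    lia. }
  intros j j' v v' Hv Hv' Hj Hj' Hjj.
  destruct (Rtotal_order v v') as [Hlt|[Heq|Hlt]]; [|exact Heq|]; exfalso.
  - apply (not_lt j' j v' v); auto; lia.
  - apply (not_lt j j' v v'); auto.
Qed.

Definition between (u v w : R) : Prop := Rmin u v <= w <= Rmax u v.

Definition interior_decreasing (y : nat -> R) (s : nat) : Prop :=
  (forall i : nat, (1 <= i <= s)%nat -> -1 < y i < 1) /\
  (forall i : nat, (1 <= i < s)%nat -> y (S i) < y i).

Definition contact_parities (r r1 r2 : nat) : Prop :=
  (r1 <= r)%nat /\ (r2 <= r)%nat /\ Nat.Even r1 /\ Nat.Odd r2.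

Section Signs.

Variables (y : nat -> R) (s : nat).
Hypothesis y_zeros : interior_decreasing y s.

Definition required_sign (x sigma : R) : Prop :=
  exists i : nat, (i <= s)%nat /\ yext y s (S i) <= x <= yext y s i /\ sigma = (-1) ^ i.

Lemma required_sign_abs x sigma : required_sign x sigma -> Rabs sigma = 1.
Proof. intros [i [_ [_ ->]]]; apply pow_1_abs. Qed.

Lemma yext_y q : (1 <= q <= s)%nat -> yext y s q = y q.
Proof.
  intros Hq; unfold yext.
  destruct (Nat.eqb_spec q 0); [lia|]; destruct (Nat.eqb_spec q (S s)); [lia | reflexivity].
Qed.

Lemma yext_last : yext y s (S s) = -1.
Proof. unfold yext; simpl; now rewrite Nat.eqb_refl. Qed.

Lemma yext_lt i j : (i < j <= S s)%nat -> yext y s j < yext y s i.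
Proof.
  assert (step : forall i, (i <= s)%nat -> yext y s (S i) < yext y s i).
  { clear i j; intros i Hi; destruct (Nat.eq_dec i s) as [->|i_neq_s].
    - rewrite yext_last; destruct (Nat.eq_dec s 0) as [->|s_pos];
        [unfold yext; simpl; lra|].
      rewrite yext_y by lia; apply y_zeros; lia.
    - rewrite (yext_y (S i)) by lia; destruct i as [|i].
      + change (y 1%nat < 1); apply y_zeros; lia.
      + rewrite yext_y by lia; apply y_zeros; lia. }
  induction j as [|j IH]; intros Hij; [lia|].
  assert (last_step := step j ltac:(lia)).
  destruct (Nat.eq_dec i j) as [->|i_neq_j]; [exact last_step|].
  apply Rlt_trans with (1 := last_step), IH; lia.
Qed.

Lemma yext_le i j : (i <= j <= S s)%nat -> yext y s j <= yext y s i.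
Proof.
  intros Hij; destruct (Nat.eq_dec i j) as [->|i_neq_j]; [lra | left; apply yext_lt; lia].
Qed.

Lemma required_sign_bounds x sigma : required_sign x sigma -> -1 <= x <= 1.
Proof.
  intros [i [Hi [Hx _]]].
  assert (low := yext_le (S i) (S s) ltac:(lia)); rewrite yext_last in low.
  assert (high := yext_le 0 i ltac:(lia)); change (yext y s 0) with 1 in high; lra.
Qed.

Lemma required_sign_exists x : -1 <= x <= 1 -> exists sigma, required_sign x sigma.
Proof.
  intros Hx.
  assert (from_below : forall m, (m <= s)%nat -> yext y s (S m) <= x ->
    exists sigma, required_sign x sigma).
  { induction m as [|m IH]; intros Hm x_ge.
    - exists ((-1) ^ 0), 0%nat; change (yext y s 0) with 1; repeat split; (lia || lra).
    - destruct (Rle_dec x (yext y s (S m))) as [x_le|x_gt]; [|apply IH; [lia | lra]].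
      exists ((-1) ^ S m), (S m); repeat split; assumption. }
  apply (from_below s); [lia | rewrite yext_last; lra].
Qed.

Lemma required_sign_const x x' sigma sigma' :
  required_sign x sigma -> required_sign x' sigma' ->
  (forall w, listed y s w -> ~ between x x' w) -> sigma = sigma'.
Proof.
  intros [i [Hi [Hx ->]]] [i' [Hi' [Hx' ->]]] no_zero; unfold between in no_zero.
  destruct (Nat.lt_trichotomy i i') as [Hlt|[->|Hlt]]; [|reflexivity|]; exfalso.
  - assert (zeros_le := yext_le (S i) i' ltac:(lia)).
    apply (no_zero (y i')); [exists i'; split; [lia | reflexivity]|].
    rewrite <- (yext_y i') by lia; rewrite Rmin_right, Rmax_left by lra; lra.
  - assert (zeros_le := yext_le (S i') i ltac:(lia)).
    apply (no_zero (y i)); [exists i; split; [lia | reflexivity]|].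
    rewrite <- (yext_y i) by lia; rewrite Rmin_left, Rmax_right by lra; lra.
Qed.

(* Near [v] the required sign is that of [sg * (x - v) ^ q]. *)
Definition sign_pattern (v : R) (q : nat) (sg : R) : Prop :=
  forall x sigma, required_sign x sigma ->
    (forall w, listed y s w -> w <> v -> ~ between v x w) ->
    (v <= x /\ sigma = sg) \/ (x <= v /\ sigma = (-1) ^ q * sg).

Lemma required_sign_near_nonzero v x sg sigma : ~ listed y s v ->
  required_sign v sg -> required_sign x sigma ->
  (forall w, listed y s w -> w <> v -> ~ between v x w) -> sigma = sg.
Proof.
  intros v_nonzero Hv Hx no_zero; symmetry.
  apply (required_sign_const v x); auto.
  intros w Hw; apply no_zero; [exact Hw | intros ->; contradiction].
Qed.

Lemma sign_pattern_nonzero v q sg : ~ listed y s v -> Nat.Even q -> required_sign v sg ->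
  sign_pattern v q sg.
Proof.
  intros v_nonzero [m ->] Hv x sigma Hx no_zero.
  rewrite pow_1_even, Rmult_1_l, (required_sign_near_nonzero v x sg sigma) by assumption.
  destruct (Rle_dec v x); [left | right]; split; auto; lra.
Qed.

Lemma sign_pattern_left_end q sg : required_sign (-1) sg -> sign_pattern (-1) q sg.
Proof.
  intros Hsg x sigma Hx no_zero; left.
  split; [apply (required_sign_bounds x sigma Hx)|].
  apply (required_sign_near_nonzero (-1) x); auto.
  intros [i [Hi y_i]]; assert (zero_inside := proj1 y_zeros i Hi); lra.
Qed.

Lemma sign_pattern_right_end q sg : required_sign 1 sg -> sign_pattern 1 q ((-1) ^ q * sg).
Proof.
  intros Hsg x sigma Hx no_zero; right.
  split; [apply (required_sign_bounds x sigma Hx)|].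
  rewrite <- Rmult_assoc, pow_neg1_mult_self, Rmult_1_l.
  apply (required_sign_near_nonzero 1 x); auto.
  intros [i [Hi y_i]]; assert (zero_inside := proj1 y_zeros i Hi); lra.
Qed.

Lemma sign_pattern_zero i q : (1 <= i <= s)%nat -> Nat.Odd q ->
  sign_pattern (y i) q ((-1) ^ (i - 1)).
Proof.
  intros Hi [m ->] x sigma [i' [Hi' [Hx ->]]] no_zero; unfold between in no_zero.
  rewrite Nat.add_1_r, pow_1_odd.
  replace (-1 * (-1) ^ (i - 1)) with ((-1) ^ i)
    by (replace i with (S (i - 1)) at 1 by lia; reflexivity).
  assert (other_zero : forall j, (1 <= j <= s)%nat -> y j <> y i ->
    ~ (Rmin (y i) x <= y j <= Rmax (y i) x)).
  { intros j Hj; apply no_zero; exists j; split; [exact Hj | reflexivity]. }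
  destruct (Nat.eq_dec i' i) as [->|i'_neq_i].
  { right; rewrite (yext_y i) in Hx by lia; split; [lra | reflexivity]. }
  destruct (Nat.eq_dec (S i') i) as [<-|i'_neq_pred].
  { left; rewrite (yext_y (S i')) in Hx by lia; split; [lra | f_equal; lia]. }
  exfalso; destruct (Nat.lt_ge_cases i i') as [Hlt|Hge].
  - assert (zeros_lt := yext_lt i i' ltac:(lia)); rewrite !yext_y in zeros_lt by lia.
    rewrite (yext_y i') in Hx by lia.
    apply (other_zero i'); [lia | lra |]; rewrite Rmin_right, Rmax_left by lra; lra.
  - assert (zeros_lt := yext_lt (S i') i ltac:(lia)); rewrite !yext_y in zeros_lt by lia.
    rewrite (yext_y (S i')) in Hx by lia.
    apply (other_zero (S i')); [lia | lra |]; rewrite Rmin_left, Rmax_right by lra; lra.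
Qed.

Variables (alpha : nat -> R) (p r r1 r2 : nat).
Hypotheses (alpha_inside : forall i : nat, (1 <= i <= p)%nat -> -1 <= alpha i <= 1)
  (y_alpha_disjoint : forall i j : nat, (1 <= i <= s)%nat -> (1 <= j <= p)%nat ->
    y i <> alpha j)
  (parities : contact_parities r r1 r2).

Lemma breakpoint_bounds v : breakpoint y s alpha p v -> -1 <= v <= 1.
Proof.
  intros [->|[->|[[i [Hi ->]]|[i [Hi ->]]]]]; try lra; [|now apply alpha_inside].
  assert (zero_inside := proj1 y_zeros i Hi); lra.
Qed.

Definition contact_order (v : R) (q : nat) : Prop :=
  (q <= r)%nat /\ (v = 1 \/ v = -1 -> q = r) /\
  (listed alpha p v -> (r1 <= q)%nat) /\ (listed y s v -> (r2 <= q)%nat).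

Lemma contact_exists v : breakpoint y s alpha p v ->
  exists q sg, contact_order v q /\ Rabs sg = 1 /\ sign_pattern v q sg.
Proof.
  destruct parities as [r1_le [r2_le [r1_even r2_odd]]].
  intros Hv; destruct (required_sign_exists v (breakpoint_bounds v Hv)) as [sg Hsg].
  assert (abs_sg := required_sign_abs v sg Hsg).
  destruct (Req_dec v 1) as [->|v_neq_1]; [|destruct (Req_dec v (-1)) as [->|v_neq_m1]].
  - exists r, ((-1) ^ r * sg); split; [now repeat split|].
    split; [rewrite Rabs_mult, pow_1_abs, abs_sg; ring | now apply sign_pattern_right_end].
  - exists r, sg; split; [now repeat split|].
    split; [exact abs_sg | now apply sign_pattern_left_end].
  - assert (not_end : ~ (v = 1 \/ v = -1)) by tauto.
    destruct Hv as [Hv|[Hv|[[i [Hi ->]]|[j [Hj ->]]]]]; [contradiction | contradiction | |].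
    + exists r2, ((-1) ^ (i - 1)); split; [|split; [apply pow_1_abs | now apply sign_pattern_zero]].
      repeat split; [exact r2_le | tauto | | lia].
      intros [j [Hj y_alpha]]; exfalso; now apply (y_alpha_disjoint i j).
    + assert (alpha_nonzero : ~ listed y s (alpha j)).
      { intros [i [Hi alpha_y]]; now apply (y_alpha_disjoint i j). }
      exists r1, sg; split; [|split; [exact abs_sg | now apply sign_pattern_nonzero]].
      repeat split; [exact r1_le | tauto | lia | contradiction].
Qed.

End Signs.

(** * The intertwining spline *)

Lemma exists_argmin (F : nat -> R) m :
  exists i, (i <= m)%nat /\ forall j, (j <= m)%nat -> F i <= F j.
Proof.
  induction m as [|m [i [Hi i_min]]].
  - exists 0%nat; split; [lia|]; intros j Hj; replace j with 0%nat by lia; lra.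
  - destruct (Rle_dec (F i) (F (S m))) as [i_le|i_gt].
    + exists i; split; [lia|]; intros j Hj.
      destruct (Nat.eq_dec j (S m)) as [->|j_neq]; [exact i_le | apply i_min; lia].
    + exists (S m); split; [lia|]; intros j Hj.
      destruct (Nat.eq_dec j (S m)) as [->|j_neq]; [lra|].
      specialize (i_min j ltac:(lia)); lra.
Qed.

Section IntertwiningSpline.

Variables (k r : nat) (f : R -> R) (Df : nat -> R -> R) (n : nat) (z : nat -> R) (C0 : R).
Hypotheses (k_pos : (1 <= k)%nat) (f_smooth : Cr_derivs (-1) 1 r f Df)
  (z_knots : knot_seq z n) (C0_constant : hermite_constant k r C0).

Local Notation t := (zext z n).

Definition window_error (a b : Z) : R := local_error C0 k r (Df r) (t a) (t b).

Lemma window_smooth a b : Cr_derivs (t a) (t b) r f Df.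
Proof.
  apply (Cr_derivs_subset (-1) 1); [apply zext_bounds, z_knots | | exact f_smooth].
  apply zext_bounds, z_knots.
Qed.

Lemma window_continuous a b : continuous_on (t a) (t b) (Df r).
Proof. exact (Cr_derivs_continuous_on _ _ r f Df r (window_smooth a b) (Nat.le_refl r)). Qed.

Lemma window_error_nonneg a b : t a < t b -> 0 <= window_error a b.
Proof.
  intros Hab; apply local_error_nonneg; auto using window_continuous; apply C0_constant.
Qed.

Lemma window_error_mono a b a' b' : (a <= a')%Z -> (b' <= b)%Z -> t a < t b ->
  window_error a b <= window_error a' b'.
Proof.
  intros Ha Hb Hab; apply local_error_mono; auto using window_continuous.
  - apply C0_constant.
  - now apply zext_antitone.
  - now apply zext_antitone.
Qed.

Lemma window_error_le (i : Z) (L : nat) : (1 <= i <= Z.of_nat n)%Z -> (1 <= L)%nat ->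
  let a := t (i + Z.of_nat L) in let b := t (i - Z.of_nat L) in
  window_error (i + Z.of_nat L) (i - Z.of_nat L) <=
  C0 * window_ratio L (rho z n) ^ r * Jlen z n i ^ r * omega k (Df r) (b - a) a b.
Proof.
  intros Hi HL a b; unfold window_error, local_error; fold a b.
  assert (a_lt_b : a < b) by (apply zext_lt; (assumption || lia)).
  assert (b_le : b <= t (i - 1 - Z.of_nat L)) by (apply zext_antitone; (assumption || lia)).
  assert (window := zext_window_le z n z_knots i L Hi); fold a in window.
  apply Rmult_le_compat_r;
    [apply omega_nonneg; [exact k_pos | exact a_lt_b | apply window_continuous]|].
  rewrite Rmult_assoc, <- Rpow_mult_distr; apply Rmult_le_compat_l; [apply C0_constant|].
  apply pow_incr; lra.
Qed.

Variables (r1 r2 e s p : nat) (y alpha : nat -> R).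
Hypotheses (order_eq : (k + r = S e)%nat) (y_zeros : interior_decreasing y s).

Local Notation E := (Z.of_nat e).

Record is_anchor (v : R) (i : Z) (P : R -> R) : Prop := {
  anchor_index : (0 <= i < Z.of_nat n)%Z;
  anchor_located : t (i + 1) <= v <= t i;
  anchor_poly : is_poly (S e) P;
  anchor_near : bounded_on (t (i + E + 2)) (t (i - E - 1)) (window_error (i + E + 2) (i - E - 1))
    (fun x => f x - P x);
  anchor_side : forall x sigma, t (i + E + 2) <= x <= t (i - E - 1) ->
    required_sign y s x sigma -> (forall w, listed y s w -> w <> v -> ~ between v x w) ->
    0 <= sigma * (P x - f x);
  anchor_contact : exists q, contact_order y s alpha p r r1 r2 v q /\ osculates q v Df P
}.

Local Notation B := (breakpoint y s alpha p).

Section Anchors.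

Hypotheses (alpha_inside : forall i : nat, (1 <= i <= p)%nat -> -1 <= alpha i <= 1)
  (y_alpha_disjoint : forall i j : nat, (1 <= i <= s)%nat -> (1 <= j <= p)%nat ->
    y i <> alpha j)
  (parities : contact_parities r r1 r2).

Lemma anchor_exists v : B v -> exists i P, is_anchor v i P.
Proof.
  intros Hv; assert (v_bounds := breakpoint_bounds y s y_zeros alpha p alpha_inside v Hv).
  destruct (contact_exists y s y_zeros alpha p r r1 r2 alpha_inside
    y_alpha_disjoint parities v Hv) as [q [sg [Hq [Hsg pattern]]]].
  destruct (zext_locate z n z_knots v v_bounds) as [i [Hi Hvi]].
  assert (window_lt : t (i + E + 2) < t (i - E - 1)) by (apply zext_lt; (assumption || lia)).
  assert (window_low : t (i + E + 2) <= t (i + 1)) by (apply zext_antitone; (assumption || lia)).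
  assert (window_high : t i <= t (i - E - 1)) by (apply zext_antitone; (assumption || lia)).
  destruct (proj2 C0_constant f Df (t (i + E + 2)) (t (i - E - 1)) v q sg
    (window_smooth _ _) window_lt ltac:(lra) (proj1 Hq) Hsg)
    as [P [HP [oscP [nearP [right_side left_side]]]]].
  exists i, P; constructor; auto.
  - now rewrite <- order_eq.
  - intros x sigma Hx Hsigma no_zero.
    destruct (pattern x sigma Hsigma no_zero) as [[Hvx ->]|[Hxv ->]];
      [now apply right_side | now apply left_side].
  - now exists q.
Qed.

Lemma anchors_exist : exists anchor : R -> R -> R,
  forall v, B v -> exists i, is_anchor v i (anchor v).
Proof.
  apply (choice (fun v P => B v -> exists i, is_anchor v i P)); intros v.
  destruct (classic (B v)) as [Hv|Hv]; [|exists (fun _ => 0); contradiction].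
  destruct (anchor_exists v Hv) as [i [P HP]]; exists P; intros _; now exists i.
Qed.

End Anchors.

Section LocalCoefficients.

Variables (anchor : R -> R -> R) (Cl : R).

(* The error on a window around the support of the j-th B-spline that contains the windows of
   all anchors met by the knot intervals in this support. *)
Definition free_error (j : Z) : R := window_error (j + 3 * E + 3) (j - 2 * E - 2).

Record is_free (j : Z) (W : R -> R) (sg : R) : Prop := {
  free_sign_abs : Rabs sg = 1;
  free_poly : is_poly (S e) W;
  free_near : bounded_on (t (j + 3 * E + 3)) (t (j - 2 * E - 2)) (free_error j)
    (fun x => f x - W x);
  free_sign : forall x sigma, touches t e j x -> required_sign y s x sigma -> sigma = sg
}.

Definition anchored_coef (j : Z) (v c : R) : Prop :=
  B v /\ touches t e j v /\ c = coef t e (anchor v) j.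

Definition raised_coef (j : Z) (W : R -> R) (sg c : R) : Prop :=
  is_free j W sg /\ c = coef t e W j + sg * ((2 * Cl + 1) * free_error j).

Definition local_coef (j : Z) (c : R) : Prop :=
  (exists v, anchored_coef j v c) \/
  ((forall v, B v -> ~ touches t e j v) /\ exists W sg, raised_coef j W sg c).

Lemma free_window_lt j : (- E <= j < Z.of_nat n)%Z -> t (j + 3 * E + 3) < t (j - 2 * E - 2).
Proof. intros Hj; apply zext_lt; (assumption || lia). Qed.

Lemma free_exists j : (- E <= j < Z.of_nat n)%Z -> (forall v, B v -> ~ touches t e j v) ->
  exists W sg, is_free j W sg.
Proof.
  intros Hj untouched; assert (window_lt := free_window_lt j Hj).
  destruct (proj2 C0_constant f Df (t (j + 3 * E + 3)) (t (j - 2 * E - 2)) (t (j + 3 * E + 3)) r 1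
    (window_smooth _ _) window_lt ltac:(lra) (Nat.le_refl r) Rabs_R1)
    as [W [HW [_ [nearW _]]]].
  destruct (required_sign_exists y s (t j) (zext_bounds z n z_knots j)) as [sg Hsg].
  exists W, sg; constructor; [now apply required_sign_abs in Hsg | now rewrite <- order_eq | |].
  - exact nearW.
  - intros x sigma Hx Hsigma; unfold touches in Hx.
    apply (required_sign_const y s y_zeros x (t j) sigma sg Hsigma Hsg).
    intros w Hw w_between; apply (untouched w); [now right; right; left|].
    unfold between in w_between; rewrite Rmin_left, Rmax_right in w_between by lra.
    unfold touches; lra.
Qed.

Lemma local_coefs_exist : exists c : Z -> R,
  forall j, (- E <= j < Z.of_nat n)%Z -> local_coef j (c j).
Proof.
  apply (choice (fun j cj => (- E <= j < Z.of_nat n)%Z -> local_coef j cj)); intros j.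
  destruct (classic (- E <= j < Z.of_nat n)%Z) as [Hj|Hj]; [|exists 0; contradiction].
  destruct (classic (exists v, B v /\ touches t e j v)) as [[v [Hv Hjv]]|untouched].
  - exists (coef t e (anchor v) j); intros _; left; now exists v.
  - assert (untouched_all : forall v, B v -> ~ touches t e j v)
      by (intros v Hv Hjv; apply untouched; now exists v).
    destruct (free_exists j Hj untouched_all) as [W [sg Hfree]].
    exists (coef t e W j + sg * ((2 * Cl + 1) * free_error j)); intros _; right.
    split; [exact untouched_all | now exists W, sg].
Qed.

Section Piece.

Variables (c : Z -> R) (i : Z) (x : R).
Hypotheses (c_spec : forall j, (- E <= j < Z.of_nat n)%Z -> local_coef j (c j))
  (Cl_constant : coef_constant e (window_ratio e (rho z n)) Cl)
  (i_range : (0 <= i < Z.of_nat n)%Z) (x_range : t (i + 1) <= x <= t i).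

Lemma free_window_le j u : active e i j -> t (i + 1) <= u <= t i ->
  t (j + 3 * E + 3) <= u <= t (j - 2 * E - 2).
Proof.
  unfold active; intros Hj Hu.
  assert (t (j + 3 * E + 3) <= t (i + 1)) by (apply zext_antitone; (assumption || lia)).
  assert (t i <= t (j - 2 * E - 2)) by (apply zext_antitone; (assumption || lia)).
  lra.
Qed.

Lemma free_error_nonneg j : active e i j -> 0 <= free_error j.
Proof. intros Hj; now apply window_error_nonneg, free_window_lt, (active_range n e i). Qed.

Lemma raised_coef_above j W sg ref : active e i j -> raised_coef j W sg (c j) ->
  is_poly (S e) ref -> bounded_on (t (i + 1)) (t i) (free_error j) (fun x => f x - ref x) ->
  (forall sigma, required_sign y s x sigma -> free_error j <= sigma * (c j - coef t e ref j)) /\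
  Rabs (c j - coef t e ref j) <= (4 * Cl + 1) * free_error j.
Proof.
  intros Hj [[abs_sg HW nearW sign_W] Ecj] Href nearRef.
  assert (HM := free_error_nonneg j Hj); set (M := free_error j) in *.
  assert (diff_small : Rabs (coef t e (fun x => 1 * W x + -1 * ref x) j) <= Cl * (2 * M)).
  { apply (coef_le_on_interval z n z_knots e Cl i); auto;
      [now apply is_poly_plus; apply is_poly_scal |].
    intros u Hu; replace (1 * W u + -1 * ref u) with ((f u - ref u) + - (f u - W u)) by ring.
    apply Rle_trans with (1 := Rabs_triang _ _); rewrite Rabs_Ropp.
    specialize (nearRef u Hu); specialize (nearW u (free_window_le j u Hj Hu)).
    simpl in *; lra. }
  rewrite coef_lin in diff_small by assumption.
  set (D := 1 * coef t e W j + -1 * coef t e ref j) in *.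
  replace (c j - coef t e ref j) with (D + sg * ((2 * Cl + 1) * M))
    by (rewrite Ecj; unfold D; ring).
  assert (HCl := proj1 Cl_constant).
  assert (raise_nonneg : 0 <= (2 * Cl + 1) * M) by (apply Rmult_le_pos; lra).
  split.
  - intros sigma Hsigma.
    rewrite (sign_W x sigma (active_touches z n z_knots e i j x Hj x_range) Hsigma).
    replace (sg * (D + sg * ((2 * Cl + 1) * M)))
      with (sg * D + (sg * sg) * ((2 * Cl + 1) * M)) by ring.
    rewrite Rabs_1_sqr by exact abs_sg.
    assert (sgD : Rabs (sg * D) <= Cl * (2 * M)) by (rewrite Rabs_mult, abs_sg; lra).
    apply Rabs_le_between in sgD; lra.
  - apply Rle_trans with (1 := Rabs_triang _ _).
    rewrite (Rabs_mult sg), abs_sg, (Rabs_pos_eq ((2 * Cl + 1) * M)) by exact raise_nonneg; lra.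
Qed.

Variables (L : Z) (N : nat).
Hypotheses (r_pos : (1 <= r)%nat) (L_large : (6 * E <= L)%Z)
  (anchor_spec : forall v, B v -> exists i, is_anchor v i (anchor v))
  (many_knots : knots_separate B z n N) (N_large : (2 * e < N)%nat).

Local Notation piece_error := (window_error (i + 1 + L) (i + 1 - L)).
Local Notation piece := (de_boor t e c e i).

Lemma free_error_le_piece j : active e i j -> free_error j <= piece_error.
Proof.
  intros Hj; apply window_error_mono; [| | now apply free_window_lt, (active_range n e i)];
    unfold active in Hj; lia.
Qed.

Lemma piece_error_nonneg : 0 <= piece_error.
Proof. apply window_error_nonneg, zext_lt; (assumption || lia). Qed.

Definition piece_estimate : Prop :=
  (forall sigma, required_sign y s x sigma -> 0 <= sigma * (piece x - f x)) /\
  Rabs (f x - piece x) <= (4 * Cl + 2) * piece_error.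

Lemma piece_estimate_of_reference ref m :
  is_poly (S e) ref -> Rabs (f x - ref x) <= piece_error ->
  (forall sigma, required_sign y s x sigma -> - m <= sigma * (ref x - f x)) ->
  (forall j, active e i j ->
    (forall sigma, required_sign y s x sigma -> m <= sigma * (c j - coef t e ref j)) /\
    Rabs (c j - coef t e ref j) <= (4 * Cl + 1) * piece_error) ->
  piece_estimate.
Proof.
  intros Href near side coefs.
  assert (Ht := zext_antitone z n z_knots).
  assert (interval_lt := zext_interval_lt z n z_knots i i_range).
  split.
  - intros sigma Hsigma; specialize (side sigma Hsigma).
    assert (m <= sigma * (piece x - ref x)).
    { apply de_boor_ge_poly; auto; intros j Hj; now apply (coefs j Hj). }
    lra.
  - assert (Rabs (piece x - ref x) <= (4 * Cl + 1) * piece_error).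
    { apply de_boor_near_poly; auto; intros j Hj; apply (coefs j Hj). }
    replace (f x - piece x) with ((f x - ref x) + - (piece x - ref x)) by ring.
    apply Rle_trans with (1 := Rabs_triang _ _); rewrite Rabs_Ropp; lra.
Qed.

Lemma raised_le_piece_error j M : active e i j -> M <= (4 * Cl + 1) * free_error j ->
  M <= (4 * Cl + 1) * piece_error.
Proof.
  intros Hj HM; apply Rle_trans with (1 := HM).
  assert (HCl := proj1 Cl_constant).
  apply Rmult_le_compat_l; [lra | now apply free_error_le_piece].
Qed.

Lemma anchor_window v iv j : is_anchor v iv (anchor v) -> active e i j -> touches t e j v ->
  (forall u, t (i + 1) <= u <= t i -> t (iv + E + 2) <= u <= t (iv - E - 1)) /\
  window_error (iv + E + 2) (iv - E - 1) <= piece_error /\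
  forall j', active e i j' -> window_error (iv + E + 2) (iv - E - 1) <= free_error j'.
Proof.
  intros [iv_range v_located _ _ _ _] Hj Hjv.
  assert (iv_near := touches_range z n z_knots e iv j v iv_range
    (active_range n e i j i_range Hj) Hjv v_located); unfold active in *.
  assert (window_lt : t (iv + E + 2) < t (iv - E - 1)) by (apply zext_lt; (assumption || lia)).
  split; [|split].
  - intros u Hu.
    assert (t (iv + E + 2) <= t (i + 1)) by (apply zext_antitone; (assumption || lia)).
    assert (t i <= t (iv - E - 1)) by (apply zext_antitone; (assumption || lia)); lra.
  - apply window_error_mono; [lia | lia | exact window_lt].
  - intros j' Hj'; apply window_error_mono; [lia | lia | exact window_lt].
Qed.

(* Every coefficient of the piece either is that of the anchor or exceeds it. *)
Lemma piece_estimate_anchored j0 v : active e i j0 -> B v -> touches t e j0 v -> piece_estimate.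
Proof.
  intros Hj0 Hv Hj0v; destruct (anchor_spec v Hv) as [iv Hanchor].
  destruct (anchor_window v iv j0 Hanchor Hj0 Hj0v) as [window [error_le error_le_free]].
  destruct Hanchor as [_ _ Href near side _].
  assert (unique := touched_breakpoint_unique z n N e y s alpha p z_knots many_knots N_large).
  apply (piece_estimate_of_reference (anchor v) 0); [exact Href | | |].
  - now apply Rle_trans with (1 := near x (window x x_range)).
  - intros sigma Hsigma; rewrite Ropp_0; apply side; [now apply window | exact Hsigma |].
    intros w Hw w_neq w_between; apply w_neq.
    apply (unique j0 j0); [now right; right; left | exact Hv | | exact Hj0v | lia].
    assert (Hj0x := active_touches z n z_knots e i j0 x Hj0 x_range); unfold touches in *.
    revert w_between; unfold between, Rmin, Rmax; destruct (Rle_dec v x); lra.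
  - intros j Hj; destruct (c_spec j (active_range n e i j i_range Hj)) as
      [[v' [Hv' [Hjv' Ecj]]]|[_ [W [sg Hraised]]]].
    + rewrite (unique j0 j v v' Hv Hv' Hj0v Hjv' ltac:(unfold active in *; lia)).
      rewrite Ecj, Rminus_diag, Rabs_R0; split; [intros sigma _; lra|].
      assert (HCl := proj1 Cl_constant).
      apply Rmult_le_pos; [lra | apply piece_error_nonneg].
    + destruct (raised_coef_above j W sg (anchor v) Hj Hraised Href) as [above close].
      { intros u Hu; apply Rle_trans with (1 := near u (window u Hu)); now apply error_le_free. }
      split; [|now apply (raised_le_piece_error j)].
      intros sigma Hsigma; apply Rle_trans with (2 := above sigma Hsigma).
      now apply free_error_nonneg.
Qed.

(* The moduli of smoothness of neighbouring windows need not be comparable, so the reference has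
   to be the local polynomial with the smallest error bound. *)
Lemma piece_estimate_free : (forall j v, active e i j -> B v -> ~ touches t e j v) ->
  piece_estimate.
Proof.
  intros untouched.
  assert (all_raised : forall j, active e i j -> exists W sg, raised_coef j W sg (c j)).
  { intros j Hj; destruct (c_spec j (active_range n e i j i_range Hj))
      as [[v [Hv [Hjv _]]]|[_ Hraised]]; [exfalso; now apply (untouched j v) | exact Hraised]. }
  destruct (exists_argmin (fun m => free_error (i - Z.of_nat m)) e) as [m [Hm m_min]].
  assert (j0_active : active e i (i - Z.of_nat m)) by (unfold active; lia).
  set (j0 := (i - Z.of_nat m)%Z) in *.
  assert (j0_min : forall j, active e i j -> free_error j0 <= free_error j).
  { unfold active; intros j Hj; specialize (m_min (Z.to_nat (i - j)) ltac:(lia)).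
    replace (i - Z.of_nat (Z.to_nat (i - j)))%Z with j in m_min by lia; exact m_min. }
  destruct (all_raised j0 j0_active) as [ref [sg0 [[_ Href near _] _]]].
  assert (near_piece : bounded_on (t (i + 1)) (t i) (free_error j0) (fun u => f u - ref u)).
  { intros u Hu; now apply near, free_window_le. }
  apply (piece_estimate_of_reference ref (free_error j0)); [exact Href | | |].
  - apply Rle_trans with (1 := near_piece x x_range); now apply free_error_le_piece.
  - intros sigma Hsigma; replace (sigma * (ref x - f x)) with (- (sigma * (f x - ref x))) by ring.
    apply Ropp_le_contravar, Rle_trans with (1 := Rle_abs _).
    rewrite Rabs_mult, (required_sign_abs y s x sigma Hsigma), Rmult_1_l.
    now apply near_piece.
  - intros j Hj; destruct (all_raised j Hj) as [W [sg Hraised]].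
    destruct (raised_coef_above j W sg ref Hj Hraised Href) as [above close].
    { intros u Hu; apply Rle_trans with (1 := near_piece u Hu); now apply j0_min. }
    split; [|now apply (raised_le_piece_error j)].
    intros sigma Hsigma; apply Rle_trans with (2 := above sigma Hsigma); now apply j0_min.
Qed.

Lemma piece_estimate_holds : piece_estimate.
Proof.
  destruct (classic (exists j v, active e i j /\ B v /\ touches t e j v))
    as [[j [v [Hj [Hv Hjv]]]]|untouched].
  - now apply (piece_estimate_anchored j v).
  - apply piece_estimate_free; intros j v Hj Hv Hjv; apply untouched; now exists j, v.
Qed.

Lemma piece_near_anchor v l : B v -> is_anchor v i (anchor v) ->
  Derive_n piece l v = Derive_n (anchor v) l v.
Proof.
  intros Hv [_ v_located HP _ _ _]; apply Derive_n_ext; intros u.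
  rewrite <- (de_boor_reproduces t e i (zext_antitone z n z_knots)
    (zext_interval_lt z n z_knots i i_range) (anchor v) u HP).
  apply de_boor_ext; intros j Hj.
  assert (Hjv := active_touches z n z_knots e i j v Hj v_located).
  destruct (c_spec j (active_range n e i j i_range Hj)) as [[v' [Hv' [Hjv' Ecj]]]|[untouched _]].
  - rewrite Ecj; do 2 f_equal.
    apply (touched_breakpoint_unique z n N e y s alpha p z_knots many_knots N_large j j); auto.
    lia.
  - exfalso; now apply (untouched v).
Qed.

End Piece.

Variable N : nat.
Hypotheses (r_pos : (1 <= r)%nat)
  (Cl_constant : coef_constant e (window_ratio e (rho z n)) Cl)
  (anchor_spec : forall v, B v -> exists i, is_anchor v i (anchor v))
  (many_knots : knots_separate B z n N) (N_large : (2 * e < N)%nat).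

Lemma intertwining_spline_of_anchors : exists DS : nat -> R -> R,
  Sigma (k + r) z n (DS 0%nat) /\ Cr_derivs (-1) 1 (k + r - 2) (DS 0%nat) DS /\
  Delta0 y s (fun x => DS 0%nat x - f x) /\
  (forall v, B v -> exists q, contact_order y s alpha p r r1 r2 v q /\
    forall l, (l < q)%nat -> DS l v = Df l v) /\
  forall i x L, (1 <= i <= Z.of_nat n)%Z -> t i <= x <= t (i - 1) -> (6 * E <= L)%Z ->
    Rabs (f x - DS 0%nat x) <= (4 * Cl + 2) * window_error (i + L) (i - L).
Proof.
  destruct local_coefs_exist as [c c_spec].
  destruct (spline_of_coefs e z n c ltac:(lia) z_knots) as [DS [DS_sigma [DS_smooth DS_piece]]].
  assert (estimate : forall i x L, (0 <= i < Z.of_nat n)%Z -> t (i + 1) <= x <= t i ->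
    (6 * E <= L)%Z -> piece_estimate c i x L)
    by (intros i x L Hi Hx HL; now apply (piece_estimate_holds c i x) with N).
  assert (DS_0 : forall i x, (0 <= i < Z.of_nat n)%Z -> t (i + 1) <= x <= t i ->
    DS 0%nat x = de_boor t e c e i x)
    by (intros i x Hi Hx; apply (DS_piece i 0%nat x Hi); lia || lra).
  exists DS; split; [now rewrite order_eq|]; split; [|split; [|split]].
  - now replace (k + r - 2)%nat with (e - 1)%nat by lia.
  - intros m Hm x Hx.
    assert (Hsign : required_sign y s x ((-1) ^ m)) by (exists m; auto).
    destruct (zext_locate z n z_knots x) as [i [Hi Hxi]];
      [now apply (required_sign_bounds y s y_zeros x ((-1) ^ m))|].
    rewrite (DS_0 i x Hi Hxi); now apply (estimate i x (6 * E)%Z Hi Hxi (Z.le_refl _)).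
  - intros v Hv; destruct (anchor_spec v Hv) as [i Hanchor].
    destruct (anchor_contact v i _ Hanchor) as [q [Hq oscq]].
    exists q; split; [exact Hq|]; intros l Hl; rewrite <- (oscq l Hl).
    rewrite (DS_piece i l v);
      [| apply Hanchor | destruct Hq as [Hqr _]; lia | apply Hanchor].
    now apply (piece_near_anchor c i c_spec (anchor_index v i _ Hanchor) N).
  - intros i x L Hi Hx HL; rewrite (DS_0 (i - 1)%Z x) by (lia || now rewrite Z.sub_add).
    destruct (estimate (i - 1)%Z x L) as [_ near]; [lia | now rewrite Z.sub_add | exact HL |].
    now rewrite Z.sub_add in near.
Qed.

End LocalCoefficients.

End IntertwiningSpline.

Definition approximates_locally (k r : nat) (C : R) (f S g : R -> R) (z : nat -> R) (n : nat) :
  Prop :=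
  forall i : nat, (i <= n)%nat ->
    let iz := Z.of_nat i in
    let L := Z.of_nat (6 * (k + r - 1) ^ 2) in
    exists a b : R,
      zext z n (iz + L) <= a /\ a <= zext z n iz /\
      zext z n (iz - 1) <= b /\ b <= zext z n (iz - L) /\
      forall x : R, zext z n iz <= x <= zext z n (iz - 1) ->
        Rabs (f x - S x) <= C * Jlen z n iz ^ r * omega k g (b - a) a b.

Lemma approximates_locally_of_windows k r C f S g z n :
  (1 <= k)%nat -> (1 <= r)%nat -> knot_seq z n -> S 1 = f 1 ->
  (forall i x, (1 <= i <= Z.of_nat n)%Z -> zext z n i <= x <= zext z n (i - 1) ->
    let L := Z.of_nat (6 * (k + r - 1) ^ 2) in
    let a := zext z n (i + L) in let b := zext z n (i - L) in
    Rabs (f x - S x) <= C * Jlen z n i ^ r * omega k g (b - a) a b) ->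
  approximates_locally k r C f S g z n.
Proof.
  intros Hk Hr Hz S_1 windows i Hi iz L.
  assert (L_pos : (1 <= L)%Z).
  { assert ((k + r - 1) ^ 2 <> 0)%nat by (apply Nat.pow_nonzero; lia); unfold L; lia. }
  exists (zext z n (iz + L)), (zext z n (iz - L)).
  split; [lra|]; split; [apply zext_antitone; (assumption || lia)|].
  split; [apply zext_antitone; (assumption || lia)|]; split; [lra|].
  intros x Hx; destruct (Nat.eq_dec i 0) as [->|i_neq_0]; [|apply windows; (assumption || lia)].
  assert (x_1 : x = 1) by (rewrite !zext_low in Hx by (assumption || lia); lra).
  rewrite Jlen_outside, pow_i, x_1, S_1, Rminus_diag, Rabs_R0 by (assumption || lia); lra.
Qed.

Lemma intertwining_spline_constant k r r1 r2 rho0 : (1 <= k)%nat -> (1 <= r)%nat ->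
  contact_parities r r1 r2 ->
  exists C, forall (s p : nat) (y alpha : nat -> R) (f : R -> R) (Df : nat -> R -> R)
    (n : nat) (z : nat -> R),
  interior_decreasing y s -> (forall i : nat, (1 <= i <= p)%nat -> -1 <= alpha i <= 1) ->
  (forall i j : nat, (1 <= i <= s)%nat -> (1 <= j <= p)%nat -> y i <> alpha j) ->
  Cr_derivs (-1) 1 r f Df -> knot_seq z n -> rho z n = rho0 ->
  knots_separate (breakpoint y s alpha p) z n (4 * (k + r - 1) ^ 2) ->
  exists DS : nat -> R -> R,
    Sigma (k + r) z n (DS 0%nat) /\ Cr_derivs (-1) 1 (k + r - 2) (DS 0%nat) DS /\
    Delta0 y s (fun x => DS 0%nat x - f x) /\
    (forall v, breakpoint y s alpha p v -> exists q, contact_order y s alpha p r r1 r2 v q /\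
      forall l, (l < q)%nat -> DS l v = Df l v) /\
    approximates_locally k r C f (DS 0%nat) (Df r) z n.
Proof.
  intros Hk Hr parities.
  set (e := (k + r - 1)%nat); set (L := (6 * e ^ 2)%nat).
  assert (e_le_sqr : (e <= e ^ 2)%nat) by (rewrite Nat.pow_2_r; apply Nat.le_mul_l; lia).
  destruct (one_sided_hermite k r Hk) as [C0 HC0].
  destruct (coef_bound e (window_ratio e rho0) (window_ratio_nonneg e rho0)) as [Cl HCl].
  exists ((4 * Cl + 2) * (C0 * window_ratio L rho0 ^ r)).
  intros s p y alpha f Df n z Hy Ha Hya Hf Hz <- many_knots.
  assert (order_eq : (k + r = S e)%nat) by (unfold e; lia).
  destruct (anchors_exist k r f Df n z C0 Hk Hf Hz HC0 r1 r2 e s p y alpha)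
    as [anchor anchor_spec]; auto.
  destruct (intertwining_spline_of_anchors k r f Df n z C0 Hk Hf Hz HC0 r1 r2 e s p y alpha
    order_eq Hy anchor Cl (4 * e ^ 2) Hr HCl anchor_spec many_knots ltac:(lia))
    as [DS [DS_sigma [DS_smooth [DS_sign [DS_contact DS_near]]]]].
  exists DS; split; [exact DS_sigma|]; split; [exact DS_smooth|]; split; [exact DS_sign|].
  split; [exact DS_contact|]; apply approximates_locally_of_windows; auto.
  - destruct (DS_contact 1 ltac:(now left)) as [q [[_ [q_end _]] contact]].
    rewrite contact by (rewrite q_end; auto); apply (proj1 Hf); lra.
  - intros i x Hi Hx; fold e L; cbv zeta.
    apply Rle_trans with (1 := DS_near i x (Z.of_nat L) Hi Hx ltac:(lia)).
    rewrite !(Rmult_assoc (4 * Cl + 2)); apply Rmult_le_compat_l;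
      [destruct HCl as [HCl _]; lra|].
    apply (window_error_le k r f Df n z C0); auto; lia.
Qed.

Lemma interpolation_orders r m1 m2 m3 :
  ((exists j : nat, (1 <= j)%nat /\ r = (2 * j)%nat /\
      m1 = (2 * Z.of_nat j - 1)%Z /\ m2 = (2 * Z.of_nat j - 2)%Z /\
      m3 = (2 * Z.of_nat j - 1)%Z)
   \/
   (exists j : nat, r = (2 * j + 1)%nat /\
      m1 = (2 * Z.of_nat j - 1)%Z /\ m2 = (2 * Z.of_nat j)%Z /\
      m3 = (2 * Z.of_nat j)%Z)) ->
  exists r1 r2, (1 <= r)%nat /\ contact_parities r r1 r2 /\
    m1 = (Z.of_nat r1 - 1)%Z /\ m2 = (Z.of_nat r2 - 1)%Z /\ m3 = (Z.of_nat r - 1)%Z.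
Proof.
  intros [[j [Hj [-> [-> [-> ->]]]]]|[j [-> [-> [-> ->]]]]].
  - exists (2 * j)%nat, (2 * (j - 1) + 1)%nat; repeat split; try lia; eexists; reflexivity.
  - exists (2 * j)%nat, (2 * j + 1)%nat; repeat split; try lia; eexists; reflexivity.
Qed.

Lemma interpolates_of_contact y s alpha p r r1 r2 (Df DS : nat -> R -> R) :
  (forall v, breakpoint y s alpha p v -> exists q, contact_order y s alpha p r r1 r2 v q /\
    forall l, (l < q)%nat -> DS l v = Df l v) ->
  (forall j l, (1 <= j <= p)%nat -> (l < r1)%nat -> DS l (alpha j) = Df l (alpha j)) /\
  (forall j l, (1 <= j <= s)%nat -> (l < r2)%nat -> DS l (y j) = Df l (y j)) /\
  (forall l, (l < r)%nat -> DS l 1 = Df l 1 /\ DS l (-1) = Df l (-1)).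
Proof.
  unfold breakpoint, contact_order; intros contact; split; [|split].
  - intros j l Hj Hl; assert (on_alpha : listed alpha p (alpha j)) by (now exists j).
    destruct (contact (alpha j)) as [q [[_ [_ [q_alpha _]]] agree]]; [tauto|].
    apply agree, Nat.lt_le_trans with r1; auto.
  - intros j l Hj Hl; assert (on_y : listed y s (y j)) by (now exists j).
    destruct (contact (y j)) as [q [[_ [_ [_ q_y]]] agree]]; [tauto|].
    apply agree, Nat.lt_le_trans with r2; auto.
  - intros l Hl; split.
    + destruct (contact 1) as [q [[_ [q_end _]] agree]]; [tauto|].
      apply agree; now rewrite q_end by tauto.
    + destruct (contact (-1)) as [q [[_ [q_end _]] agree]]; [tauto|].
      apply agree; now rewrite q_end by tauto.
Qed.

Theorem theorem4p10 :
  forall (k r : nat) (m1 m2 m3 : Z),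
    (1 <= k)%nat ->
    ((exists j : nat, (1 <= j)%nat /\ r = (2 * j)%nat /\
        m1 = (2 * Z.of_nat j - 1)%Z /\ m2 = (2 * Z.of_nat j - 2)%Z /\
        m3 = (2 * Z.of_nat j - 1)%Z)
     \/
     (exists j : nat, r = (2 * j + 1)%nat /\
        m1 = (2 * Z.of_nat j - 1)%Z /\ m2 = (2 * Z.of_nat j)%Z /\
        m3 = (2 * Z.of_nat j)%Z)) ->
    exists c : R -> R,
    forall (s p : nat) (y alpha : nat -> R) (f : R -> R) (Df : nat -> R -> R)
           (n : nat) (z : nat -> R),
      (1 <= p)%nat ->
      (* Y_s : -1 < y_s < ... < y_1 < 1 *)
      (forall i : nat, (1 <= i <= s)%nat -> -1 < y i < 1) ->
      (forall i : nat, (1 <= i < s)%nat -> y (S i) < y i) ->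
      (* A_p : -1 <= alpha_p < ... < alpha_1 <= 1 *)
      (forall i : nat, (1 <= i <= p)%nat -> -1 <= alpha i <= 1) ->
      (forall i : nat, (1 <= i < p)%nat -> alpha (S i) < alpha i) ->
      (* Y_s and A_p are disjoint *)
      (forall i j : nat, (1 <= i <= s)%nat -> (1 <= j <= p)%nat -> y i <> alpha j) ->
      (* f in C^r[-1,1], with derivatives Df i = f^(i) on [-1,1] *)
      Cr_derivs (-1) 1 r f Df ->
      (* Z_n is a knot sequence *)
      knot_seq z n ->
      (* every nonempty open interval (beta_j, beta_{j-1}) between consecutive
         points of {-1,1} u Y_s u A_p contains >= 4(k+r-1)^2 knots *)
      (let inB (v : R) :=
         v = 1 \/ v = -1 \/
         (exists i : nat, (1 <= i <= s)%nat /\ v = y i) \/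
         (exists i : nat, (1 <= i <= p)%nat /\ v = alpha i) in
       forall a b : R, inB a -> inB b -> a < b ->
         (forall v, inB v -> ~ (a < v < b)) ->
         (4 * (k + r - 1) ^ 2 <= knots_in z n a b)%nat) ->
      exists (S : R -> R) (DS : nat -> R -> R),
        Sigma (k + r) z n S /\
        Cr_derivs (-1) 1 (k + r - 2) S DS /\
        Delta0 y s (fun x => S x - f x) /\
        (forall (j i : nat), (1 <= j <= p)%nat -> (Z.of_nat i <= m1)%Z ->
            DS i (alpha j) = Df i (alpha j)) /\
        (forall (j i : nat), (1 <= j <= s)%nat -> (Z.of_nat i <= m2)%Z ->
            DS i (y j) = Df i (y j)) /\
        (forall i : nat, (Z.of_nat i <= m3)%Z ->
            DS i 1 = Df i 1 /\ DS i (-1) = Df i (-1)) /\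
        (forall i : nat, (i <= n)%nat ->
           let iz := Z.of_nat i in
           let L := Z.of_nat (6 * (k + r - 1) ^ 2) in
           exists a b : R,
             (* J_i = [z_i, z_{i-1}] subset hatJ_i = [a,b]
                subset [z_{i+6(k+r-1)^2}, z_{i-6(k+r-1)^2}] *)
             zext z n (iz + L) <= a /\ a <= zext z n iz /\
             zext z n (iz - 1) <= b /\ b <= zext z n (iz - L) /\
             forall x : R, zext z n iz <= x <= zext z n (iz - 1) ->
               Rabs (f x - S x) <=
                 c (rho z n) * (Jlen z n iz) ^ r * omega k (Df r) (b - a) a b).
Proof.
  intros k r m1 m2 m3 Hk orders.
  destruct (interpolation_orders r m1 m2 m3 orders)
    as [r1 [r2 [Hr [parities [-> [-> ->]]]]]].
  destruct (choice _ (fun rho0 => intertwining_spline_constant k r r1 r2 rho0 Hk Hr parities))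
    as [c Hc].
  exists c; intros s p y alpha f Df n z _ Hy Hy_dec Ha _ Hya Hf Hz many_knots.
  destruct (Hc (rho z n) s p y alpha f Df n z (conj Hy Hy_dec) Ha Hya Hf Hz eq_refl many_knots)
    as [DS [DS_sigma [DS_smooth [DS_sign [DS_contact DS_near]]]]].
  destruct (interpolates_of_contact _ _ _ _ _ _ _ _ _ DS_contact) as [at_alpha [at_y at_ends]].
  exists (DS 0%nat), DS; split; [exact DS_sigma|]; split; [exact DS_smooth|].
  split; [exact DS_sign|].
  split; [intros j i Hj Hi; apply at_alpha; lia|].
  split; [intros j i Hj Hi; apply at_y; lia|].
  split; [intros i Hi; apply at_ends; lia | exact DS_near].
Qed.
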